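(* Let $\mathbb{F}$ be an algebraically closed field of characteristic $p>3$. For any $c\in\mathbb{F}$, the vertex superalgebra $V_{\mathcal{NS}}^0(c,0)$ has only finitely many irreducible $\mathbb{N}$-graded $\sigma$-twisted modules (up to isomorphism), where $\sigma$ is the parity automorphism, and the number of such irreducible $\sigma$-twisted $V_{\mathcal{NS}}^0(c,0)$-modules is no more than $2p$.
   Context: Conventions. $\mathbb{N}=\{0,1,2,\dots\}$; rational numbers with denominator prime to $p$ (in particular $\binom\alpha i$ with $\alpha\in\frac12\mathbb{Z}$) are read in $\mathbb{F}$ via reduction mod $p$; $(z_1+z_2)^\alpha:=\sum_{i\ge0}\binom\alpha iz_1^{\alpha-i}z_2^i$; $\delta(z)=\sum_{n\in\mathbb{Z}}z^n$. A vertex superalgebra is a $\mathbb{Z}_2$-graded space $V$ with an even vector $\mathbf 1$ and a linear map $v\mapsto Y(v,x)=\sum_{n\in\mathbb{Z}}v_nx^{-n-1}\in(\mathrm{End}\,V)[[x,x^{-1}]]$ with $u_nv$ of parity $|u|+|v|$, $u_nv=0$ for $n$ large, $Y(\mathbf 1,x)=1_V$, $Y(v,x)\mathbf 1\in V[[x]]$ with constant term $v$, and the Jacobi identity $$x_0^{-1}\delta\Big(\tfrac{x_1-x_2}{x_0}\Big)Y(u,x_1)Y(v,x_2)-(-1)^{|u||v|}x_0^{-1}\delta\Big(\tfrac{x_2-x_1}{-x_0}\Big)Y(v,x_2)Y(u,x_1)=x_2^{-1}\delta\Big(\tfrac{x_1-x_0}{x_2}\Big)Y(Y(u,x_0)v,x_2).$$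 The parity automorphism is $\sigma(v)=(-1)^{|v|}v$. A $\sigma$-twisted $V$-module is a vector space $W$ (not necessarily $\mathbb{Z}_2$-graded) with a linear map $v\mapsto Y_W(v,x)=\sum_{n\in\frac12\mathbb{Z}}v_nx^{-n-1}\in(\mathrm{End}\,W)[[x^{1/2},x^{-1/2}]]$ such that for $u\in V_{\bar r}$ ($r\in\{0,1\}$): $Y_W(u,x)=\sum_{n\in\frac r2+\mathbb{Z}}u_nx^{-n-1}$; $u_nw=0$ for $n$ large; $Y_W(\mathbf 1,x)=1_W$; and the Jacobi identity holds with $Y$ on the left replaced by $Y_W$ and right side replaced by $x_2^{-1}\delta\big(\tfrac{x_1-x_0}{x_2}\big)\big(\tfrac{x_1-x_0}{x_2}\big)^{-r/2}Y_W(Y(u,x_0)v,x_2)$. When $V=\bigoplus_{q\in\frac12\mathbb{Z}}V_q$ is $\frac12\mathbb{Z}$-graded, $W$ is $\mathbb{N}$-graded if $W=\bigoplus_{n\in\mathbb{N}}W_n$ with $W_0\neq0$ and $u_nW_r\subset W_{r+q-n-1}$ for $u\in V_q$, $n\in\frac12\mathbb{Z}$. Neveu-Schwarz algebra $\mathcal{NS}$: Lie superalgebra with basis $L_n,G_{n+\frac12}$ ($n\in\mathbb{Z}$), $\mathbf c$; $L_n,\mathbf c$ even, $G_{n+\frac12}$ odd, $\mathbf c$ central, $[L_m,L_n]=(m-n)L_{m+n}+\frac12\binom{m+1}3\delta_{m+n,0}\mathbf c$, $[L_m,G_{n+\frac12}]=(\frac m2-n-\frac12)G_{m+n+\frac12}$,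 $[G_{m+\frac12},G_{n-\frac12}]=2L_{m+n}+\frac13m(m+1)\delta_{m+n,0}\mathbf c$. For $c\in\mathbb{F}$, $V_{\mathcal{NS}}(c,0)=U(\mathcal{NS})\otimes_{U(\mathcal{NS}_* )}\mathbb{F}_c$, where $\mathcal{NS}_*$ is spanned by $L_n$ ($n\ge-1$), $G_{n+\frac12}$ ($n\ge-1$) and $\mathbf c$, and on the one-dimensional module $\mathbb{F}_c$ all these $L_n,G_{n+\frac12}$ act as $0$ and $\mathbf c$ as $c$. It is a $\frac12\mathbb{Z}$-graded vertex superalgebra with vacuum $\mathbf 1=1\otimes1$, $Y(L_{-2}\mathbf 1,z)=\sum_{m\in\mathbb{Z}}L_mz^{-m-2}$, $Y(G_{-\frac32}\mathbf 1,z)=\sum_{n\in\mathbb{Z}}G_{n+\frac12}z^{-n-2}$, $\deg\mathbf 1=0$, $L_{-m}$ of degree $m$, $G_{-m-\frac12}$ of degree $m+\frac12$. Let $I_0$ be the ideal of the vertex superalgebra $V_{\mathcal{NS}}(c,0)$ generated by the vectors $(L_{-n}^p-\delta_{p\mid n}L_{-np})\mathbf 1$ for $n\ge2$, where $\delta_{p\mid n}=1$ if $p\mid n$ and $0$ otherwise. Then $V_{\mathcal{NS}}^0(c,0)=V_{\mathcal{NS}}(c,0)/I_0$, a $\frac12\mathbb{Z}$-graded vertex superalgebra. *)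

(* Defs.v *)
From HB Require Import structures.
From mathcomp Require Import all_boot all_order all_algebra.
From mathcomp Require Import boolp classical_sets functions cardinality fsbigop.
From mathcomp Require Import monalg.

Set Implicit Arguments.
Unset Strict Implicit.
Unset Printing Implicit Defensive.

Import Order.TTheory GRing.Theory Num.Theory.

Local Open Scope classical_set_scope.
Local Open Scope quotient_scope.
Local Open Scope ring_scope.

Definition is_subspace (F : fieldType) (V : lmodType F) (S : set V) : Prop :=
  S 0 /\ forall (a : F) (u v : V), S u -> S v -> S (a *: u + v).

Record subspace (F : fieldType) (V : lmodType F) := Subspace {
  sub_set :> V -> Prop;
  sub_is_subspace : is_subspace sub_set }.

Section Span.
Variables (F : fieldType) (V : lmodType F) (S : set V).

Definition span_set : set V :=
  [set v | forall J : set V, is_subspace J -> S `<=` J -> J v].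

Lemma span_is_subspace : is_subspace span_set.
Proof.
split=> [J [J0 _] _ //|a u v hu hv J hJ SJ].
by apply: hJ.2; [apply: hu | apply: hv].
Qed.

Definition span : subspace V := Subspace span_is_subspace.

End Span.

Section LinearQuotient.
Variables (F : fieldType) (V : lmodType F) (S : subspace V).

Definition sub_pred : {pred V} := fun v => `[< S v >].

Lemma sub_predP v : (v \in sub_pred) = `[< S v >]. Proof. by []. Qed.

Lemma sub_pred_zmod : zmod_closed sub_pred.
Proof.
have [S0 SD] := sub_is_subspace S.
split=> [|u v]; first by rewrite sub_predP; apply/asboolP.
rewrite !sub_predP => /asboolP Su /asboolP Sv; apply/asboolP.
by rewrite addrC -scaleN1r; apply: SD.
Qed.

HB.instance Definition _ := GRing.isZmodClosed.Build V sub_pred sub_pred_zmod.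

Definition lquot : Type := Quotient.quot sub_pred.

HB.instance Definition _ := GRing.Zmodule.on lquot.

Definition cls (v : V) : lquot := \pi_(Quotient.quot sub_pred) v.
Definition rep (q : lquot) : V := repr (q : Quotient.quot sub_pred).

Lemma repK q : cls (rep q) = q. Proof. exact: reprK. Qed.

Lemma cls_eqP u v : cls u = cls v <-> S (u - v).
Proof.
split=> [/eqP|h]; first by rewrite -Quotient.idealrBE sub_predP => /asboolP.
by apply/eqP; rewrite -Quotient.idealrBE sub_predP; apply/asboolP.
Qed.

Lemma clsD u v : cls (u + v) = cls u + cls v.
Proof. by rewrite /cls !piE. Qed.

Lemma cls_rep v : S (rep (cls v) - v).
Proof. by apply/cls_eqP; rewrite repK. Qed.

Lemma subZ a v : S v -> S (a *: v).
Proof.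
have [S0 SD] := sub_is_subspace S.
by move=> Sv; rewrite -[a *: v]addr0; apply: SD.
Qed.

Lemma subD u v : S u -> S v -> S (u + v).
Proof.
have [S0 SD] := sub_is_subspace S.
by move=> Su Sv; rewrite -[u]scale1r; apply: SD.
Qed.

Definition lquot_scale (a : F) (q : lquot) : lquot := cls (a *: rep q).

Lemma lquot_scaleE a v : lquot_scale a (cls v) = cls (a *: v).
Proof. by apply/cls_eqP; rewrite -scalerBr; apply/subZ/cls_rep. Qed.

Lemma lquot_scaleA a b q :
  lquot_scale a (lquot_scale b q) = lquot_scale (a * b) q.
Proof. by rewrite -[q]repK !lquot_scaleE scalerA. Qed.

Lemma lquot_scale1 : left_id 1 lquot_scale.
Proof. by move=> q; rewrite -[q]repK !lquot_scaleE scale1r. Qed.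

Lemma lquot_scaleDr : right_distributive lquot_scale +%R.
Proof.
move=> a q q'; rewrite -[q]repK -[q']repK -clsD !lquot_scaleE -clsD.
by rewrite scalerDr.
Qed.

Lemma lquot_scaleDl q : {morph lquot_scale^~ q : a b / a + b}.
Proof. by move=> a b; rewrite -[q]repK !lquot_scaleE -clsD scalerDl. Qed.

HB.instance Definition _ := GRing.Zmodule_isLmodule.Build F lquot
  lquot_scaleA lquot_scale1 lquot_scaleDr lquot_scaleDl.

Lemma clsZ a v : cls (a *: v) = a *: cls v.
Proof. by rewrite -lquot_scaleE. Qed.

Lemma cls_is_linear : linear cls.
Proof. by move=> a u v; rewrite clsD clsZ. Qed.

HB.instance Definition _ := GRing.isLinear.Build F V lquot _ cls cls_is_linear.

End LinearQuotient.

(* The binomial coefficient of a rational number, reduced into F (ratr sends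
   n / d to n%:~R / d%:~R, which is reduction mod p when p does not divide d). *)
Definition binc (F : fieldType) (a : rat) (i : nat) : F :=
  ratr ((\prod_(j < i) (a - j%:R)) / i`!%:R).

(* The coefficient of x0^(-l-1) x1^(-m-1) x2^(-n-1) in the Jacobi identity,
   for u of parity r and v of parity s. The factor (-1) ^ l comes from
   x0^(-1) ((x2 - x1) / (- x0))^l; on the right, (-1)^i binom(i - m - 1, i) = binom(m, i). The sums over i have finite
   support by the truncation condition, and \sum_(i \in _) is the sum of a
   finitely supported family. *)
Definition jacobi_coef (F : fieldType) (V : lmodType F)
    (Y : V -> int -> V -> V) (r s : bool) (u v w : V) (l m n : int) : Prop :=
  \sum_(i \in [set: nat])
     ((-1) ^+ i * binc F l%:~R i) *: Y u (m + l - i%:Z) (Y v (n + i%:Z) w)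
  - (-1) ^+ (r && s) *:
    \sum_(i \in [set: nat])
       ((-1) ^ l * (-1) ^+ i * binc F l%:~R i) *:
         Y v (n + l - i%:Z) (Y u (m + i%:Z) w)
  = \sum_(i \in [set: nat])
       binc F m%:~R i *: Y (Y u (l + i%:Z) v) (m + n - i%:Z) w.

(* Y v n is the mode v_n, and par false, par true are the even and the odd
   part. *)
Record vertex_superalgebra (F : fieldType) (V : lmodType F) := VSA {
  par : bool -> set V;
  vac : V;
  Y : V -> int -> V -> V;
  par_subspace : forall r, is_subspace (par r);
  par_sum : forall v, exists v0 v1, [/\ par false v0, par true v1 & v = v0 + v1];
  par_direct : forall v, par false v -> par true v -> v = 0;
  Y_linearl : forall n w, linear (fun v => Y v n w);
  Y_linearr : forall v n, linear (Y v n);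
  Y_par : forall r s u v n, par r u -> par s v -> par (r (+) s) (Y u n v);
  Y_trunc : forall u v, exists N : int, forall n, N <= n -> Y u n v = 0;
  vac_even : par false vac;
  Y_vac : forall n w, Y vac n w = if n == -1 then w else 0;
  Y_creation0 : forall v n, 0 <= n -> Y v n vac = 0;
  Y_creation1 : forall v, Y v (-1) vac = v;
  Y_jacobi : forall r s u v, par r u -> par s v ->
    forall w l m n, jacobi_coef Y r s u v w l m n }.

Section Quotient.
Variables (F : fieldType) (V : lmodType F) (A : vertex_superalgebra V).

(* Ideals are Z_2-graded, so that quotients are again superalgebras. *)
Definition is_ideal (J : set V) : Prop :=
  [/\ is_subspace J,
      forall u n v, J v -> J (Y A u n v),
      forall u n v, J u -> J (Y A u n v) &
      forall v0 v1, par A false v0 -> par A true v1 -> J (v0 + v1) ->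
        J v0 /\ J v1].

Record ideal := Ideal { ideal_set :> V -> Prop; ideal_is_ideal : is_ideal ideal_set }.

Definition gen_ideal_set (S : set V) : set V :=
  [set v | forall J : set V, is_ideal J -> S `<=` J -> J v].

Lemma gen_ideal_is_ideal S : is_ideal (gen_ideal_set S).
Proof.
split.
- split=> [J [[J0 _] _ _ _] _ //|a u v hu hv J hJ SJ].
  have [[_ JD] _ _ _] := hJ.
  by apply: JD; [apply: hu | apply: hv].
- move=> u n v hv J hJ SJ; have [_ J2 _ _] := hJ.
  by apply: J2; apply: hv.
- move=> u n v hu J hJ SJ; have [_ _ J3 _] := hJ.
  by apply: J3; apply: hu.
- move=> v0 v1 h0 h1 hv; split=> J hJ SJ; have [_ _ _ J4] := hJ.
    by have [] := J4 _ _ h0 h1 (hv J hJ SJ).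
  by have [] := J4 _ _ h0 h1 (hv J hJ SJ).
Qed.

Definition gen_ideal (S : set V) : ideal := Ideal (gen_ideal_is_ideal S).

Variable J : ideal.

Lemma ideal_is_subspace : is_subspace J.
Proof. by case: (ideal_is_ideal J). Qed.

Definition ideal_subspace : subspace V := Subspace ideal_is_subspace.

Local Notation Q := (lquot ideal_subspace).
Local Notation pi := (@cls F V ideal_subspace).
Local Notation rho := (@rep F V ideal_subspace).

Definition quot_par (r : bool) : set Q := pi @` par A r.
Definition quot_Y (u : Q) (n : int) (v : Q) : Q := pi (Y A (rho u) n (rho v)).

Lemma quot_YE u n v : quot_Y (pi u) n (pi v) = pi (Y A u n v).
Proof.
have [_ J2 J3 _] := ideal_is_ideal J.
have E a b c : Y A (a - b) n c = Y A a n c - Y A b n c.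
  by rewrite -[a - b]addrC -scaleN1r Y_linearl scaleN1r addrC.
have E' a b c : Y A c n (a - b) = Y A c n a - Y A c n b.
  by rewrite -[a - b]addrC -scaleN1r Y_linearr scaleN1r addrC.
rewrite /quot_Y; transitivity (pi (Y A u n (rho (pi v)))); apply/cls_eqP => /=.
  by rewrite -E; apply: J3; exact: (cls_rep ideal_subspace).
by rewrite -E'; apply: J2; exact: (cls_rep ideal_subspace).
Qed.

Lemma finsum_trunc (U : lmodType F) (f : nat -> U) (N : nat) :
  (forall i, (N <= i)%N -> f i = 0) ->
  \sum_(i \in [set: nat]) f i = \sum_(i < N) f i.
Proof.
move=> hf; rewrite (fsbigE (iota 0 N)) ?iota_uniq //.
  rewrite -[LHS]big_filter -[LHS]/(\sum_(i <- _) f i).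
  have -> : [seq i <- iota 0 N | i \in [set: nat]] = iota 0 N.
    by rewrite (eq_filter (a2 := predT)) ?filter_predT // => i; rewrite in_setT.
  by rewrite -[N in iota _ N]subn0 -[LHS]/(\sum_(0 <= i < N) f i) big_mkord.
move=> i _; rewrite mem_iota /= add0n -leqNgt; exact: hf.
Qed.

Lemma pi_finsum (f : nat -> V) (N : nat) :
  (forall i, (N <= i)%N -> f i = 0) ->
  \sum_(i \in [set: nat]) pi (f i) = pi (\sum_(i \in [set: nat]) f i).
Proof.
move=> hf; rewrite (finsum_trunc hf) (finsum_trunc (N := N)) ?raddf_sum //.
by move=> i /hf ->; rewrite raddf0.
Qed.

Lemma quot_linearl n w : linear (fun v => quot_Y v n w).
Proof.
move=> a u v; rewrite -[u]repK -[v]repK -[w]repK -linearP !quot_YE Y_linearl.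
by rewrite linearP.
Qed.

Lemma quot_linearr v n : linear (quot_Y v n).
Proof.
move=> a u w; rewrite -[u]repK -[v]repK -[w]repK -linearP !quot_YE Y_linearr.
by rewrite linearP.
Qed.

Lemma bound_nat (N n : int) : exists M : nat, forall i, (M <= i)%N -> N <= n + i%:Z.
Proof.
exists `|N - n|%N => i hi; rewrite addrC -lerBlDr.
apply: le_trans (ler_norm _) _; rewrite -abszE; exact: hi.
Qed.

Lemma Y0l n w : Y A 0 n w = 0.
Proof. by have := Y_linearl A n w (-1) 0 0; rewrite scaler0 addr0 scaleN1r addNr. Qed.

Lemma Y0r v n : Y A v n 0 = 0.
Proof. by have := Y_linearr A v n (-1) 0 0; rewrite scaler0 addr0 scaleN1r addNr. Qed.

Lemma quot_jacobi r s u v : quot_par r u -> quot_par s v ->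
  forall w l m n, jacobi_coef quot_Y r s u v w l m n.
Proof.
move=> [u' hu <-] [v' hv <-] w l m n; rewrite -[w]repK.
move: (rho w) => {}w; have := Y_jacobi hu hv w l m n; rewrite /jacobi_coef => E.
have [N1 h1] := Y_trunc A v' w; have [M1 k1] := bound_nat N1 n.
have [N2 h2] := Y_trunc A u' w; have [M2 k2] := bound_nat N2 m.
have [N3 h3] := Y_trunc A u' v'; have [M3 k3] := bound_nat N3 l.
under eq_fsbigr do rewrite !quot_YE -linearZ.
rewrite (pi_finsum (N := M1)); last first.
  by move=> i /k1 /h1 ->; rewrite Y0r scaler0.
under [X in _ - _ *: X]eq_fsbigr do rewrite !quot_YE -linearZ.
rewrite (pi_finsum (N := M2)); last first.
  by move=> i /k2 /h2 ->; rewrite Y0r scaler0.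
under [RHS]eq_fsbigr do rewrite !quot_YE -linearZ.
rewrite (pi_finsum (N := M3)); last first.
  by move=> i /k3 /h3 ->; rewrite Y0l scaler0.
by rewrite -E -linearZ -linearB.
Qed.

Lemma quot_par_subspace r : is_subspace (quot_par r).
Proof.
have [h0 hD] := par_subspace A r; split; first by exists 0; rewrite ?raddf0.
move=> a _ _ [u hu <-] [v hv <-]; exists (a *: u + v); first exact: hD.
by rewrite linearP.
Qed.

Lemma quot_par_sum v : exists v0 v1,
  [/\ quot_par false v0, quot_par true v1 & v = v0 + v1].
Proof.
have [v0 [v1 [h0 h1 E]]] := par_sum A (rho v).
exists (pi v0), (pi v1); split; [by exists v0 | by exists v1 |].
by rewrite -[LHS]repK E clsD.
Qed.

Lemma quot_par_direct v : quot_par false v -> quot_par true v -> v = 0.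
Proof.
move=> [u hu <-] [w hw E]; have [_ _ _ J4] := ideal_is_ideal J.
have hN : par A true (- w).
  have [h0 hD] := par_subspace A true.
  by rewrite -[- w]addr0 -scaleN1r; apply: hD.
have h : J (u + - w).
  by have /(cls_eqP ideal_subspace) := esym E.
have [Ju _] := J4 _ _ hu hN h.
rewrite -(raddf0 pi); apply/(cls_eqP ideal_subspace).
by rewrite subr0.
Qed.

Lemma quot_Y_par r s u v n :
  quot_par r u -> quot_par s v -> quot_par (r (+) s) (quot_Y u n v).
Proof.
move=> [u' hu <-] [v' hv <-]; exists (Y A u' n v'); first exact: Y_par.
by rewrite quot_YE.
Qed.

Lemma quot_Y_trunc u v : exists N : int, forall n, N <= n -> quot_Y u n v = 0.
Proof.
have [N h] := Y_trunc A (rho u) (rho v); exists N => n /h E.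
by rewrite /quot_Y E raddf0.
Qed.

Lemma quot_vac_even : quot_par false (pi (vac A)).
Proof. by exists (vac A) => //; apply: vac_even. Qed.

Lemma quot_Y_vac n w : quot_Y (pi (vac A)) n w = if n == -1 then w else 0.
Proof.
by rewrite -[w]repK quot_YE Y_vac; case: ifP => _ //; rewrite raddf0.
Qed.

Lemma quot_creation0 v n : 0 <= n -> quot_Y v n (pi (vac A)) = 0.
Proof. by move=> hn; rewrite -[v]repK quot_YE Y_creation0 ?raddf0. Qed.

Lemma quot_creation1 v : quot_Y v (-1) (pi (vac A)) = v.
Proof. by rewrite -[v]repK quot_YE Y_creation1. Qed.

Definition quot_vsa : vertex_superalgebra Q :=
  VSA quot_par_subspace quot_par_sum quot_par_direct quot_linearl quot_linearr
    quot_Y_par quot_Y_trunc quot_vac_even quot_Y_vac quot_creation0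
    quot_creation1 quot_jacobi.

End Quotient.

(* Elements of 1/2 Z are encoded by their doubles throughout: the integer k
   stands for k / 2. *)
Definition in_coset (r : bool) (k : int) : bool := (k == r%:Z %[mod 2])%Z.

(* As jacobi_coef, with the extra factor ((x1 - x0) / x2)^(-r/2) on the right:
   the coefficient of x0^(-l-1) x1^(-m/2-1) x2^(-n/2-1), for m / 2 in r / 2 + Z
   and n / 2 in s / 2 + Z (for other exponents in 1/2 Z both sides vanish). *)
Definition twisted_jacobi_coef (F : fieldType) (V W : lmodType F)
    (Y : V -> int -> V -> V) (YW : V -> int -> W -> W) (r s : bool)
    (u v : V) (w : W) (l m n : int) : Prop :=
  \sum_(i \in [set: nat])
     ((-1) ^+ i * binc F l%:~R i) *:
       YW u (m + l *+ 2 - i%:Z *+ 2) (YW v (n + i%:Z *+ 2) w)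
  - (-1) ^+ (r && s) *:
    \sum_(i \in [set: nat])
       ((-1) ^ l * (-1) ^+ i * binc F l%:~R i) *:
         YW v (n + l *+ 2 - i%:Z *+ 2) (YW u (m + i%:Z *+ 2) w)
  = \sum_(i \in [set: nat])
       binc F (m%:~R / 2%:R) i *: YW (Y u (l + i%:Z) v) (m + n - i%:Z *+ 2) w.

(* Modules twisted by the parity automorphism; YW u k is the mode u_(k/2). *)
Record twisted_module (F : fieldType) (V : lmodType F)
    (A : vertex_superalgebra V) := TwistedModule {
  tm_car :> lmodType F;
  YW : V -> int -> tm_car -> tm_car;
  YW_linearl : forall k w, linear (fun v => YW v k w);
  YW_linearr : forall v k, linear (YW v k);
  YW_coset : forall r u, par A r u ->
    forall k w, ~~ in_coset r k -> YW u k w = 0;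
  YW_trunc : forall u w, exists N : int, forall k, N <= k -> YW u k w = 0;
  YW_vac : forall k w, YW (vac A) k w = if k == -2 then w else 0;
  YW_jacobi : forall r s u v, par A r u -> par A s v ->
    forall w l m n, in_coset r m -> in_coset s n ->
    twisted_jacobi_coef (Y A) YW r s u v w l m n }.

Section TwistedModules.
Variables (F : fieldType) (V : lmodType F) (A : vertex_superalgebra V).

Definition tm_irreducible (W : twisted_module A) : Prop :=
  (exists w : W, w <> 0) /\
  forall S : set W, is_subspace S ->
    (forall u k w, S w -> S (YW u k w)) ->
    S = [set 0] \/ S = [set: W].

Definition tm_iso (W W' : twisted_module A) : Prop :=
  exists f : {linear W -> W'},
    bijective f /\ forall u k w, f (YW u k w) = YW u k (f w).

Definition direct_sum_decomposition (W : lmodType F) (gr : nat -> set W) : Prop :=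
  [/\ forall n, is_subspace (gr n),
      forall w, exists N (f : nat -> W),
        (forall n, gr n (f n)) /\ w = \sum_(n < N) f n &
      forall N (f : nat -> W), (forall n, gr n (f n)) ->
        \sum_(n < N) f n = 0 -> forall n, (n < N)%N -> f n = 0].

(* deg k is the component V_(k/2) of the algebra; the target component
   W_(r + q - n - 1) is 0 unless its index is in N. *)
Definition tm_Ngraded (deg : int -> set V) (W : twisted_module A) : Prop :=
  exists gr : nat -> set W,
    [/\ direct_sum_decomposition gr,
        exists2 w, gr 0%N w & w <> 0 &
        forall q k r u w, deg q u -> gr r w ->
          let t := r%:Z *+ 2 + q - k - 2 in
          (forall j : nat, t = j%:Z *+ 2 -> gr j (YW u k w)) /\
          ((forall j : nat, t <> j%:Z *+ 2) -> YW u k w = 0)].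

End TwistedModules.

(* The basis of the Neveu-Schwarz algebra: NSL n is L_n, NSG n is G_(n+1/2). *)
Inductive NSgen := NSL of int | NSG of int | NSC.

Definition NSgen_code (x : NSgen) : int + (int + unit) :=
  match x with NSL n => inl n | NSG n => inr (inl n) | NSC => inr (inr tt) end.
Definition NSgen_decode (y : int + (int + unit)) : NSgen :=
  match y with inl n => NSL n | inr (inl n) => NSG n | inr (inr _) => NSC end.
Lemma NSgen_codeK : cancel NSgen_code NSgen_decode. Proof. by case. Qed.

HB.instance Definition _ := Choice.copy NSgen (can_type NSgen_codeK).

Definition NSpar (x : NSgen) : bool := if x is NSG _ then true else false.

(* Twice the degree. *)
Definition NSdeg (x : NSgen) : int :=
  match x with NSL n => - (n *+ 2) | NSG n => - (n *+ 2 + 1) | NSC => 0 end.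

Section NeveuSchwarz.
Variable F : fieldType.

(* The free associative algebra on the basis, i.e. the tensor algebra. *)
Definition NST := {malg F[{fmonom NSgen}]}.

Definition NSe (x : NSgen) : NST := << fmu x >>.

(* The bracket of two basis elements, as an element of the tensor algebra. *)
Definition NSbracket (x y : NSgen) : NST :=
  match x, y with
  | NSL m, NSL n =>
      (m - n)%:~R *: NSe (NSL (m + n))
      + (if m + n == 0 then 2%:R^-1 * binc F (m + 1)%:~R 3 else 0) *: NSe NSC
  | NSL m, NSG n => (m%:~R / 2%:R - n%:~R - 2%:R^-1) *: NSe (NSG (m + n))
  | NSG n, NSL m => - (m%:~R / 2%:R - n%:~R - 2%:R^-1) *: NSe (NSG (m + n))
  | NSG m, NSG n =>
      (* G_(n+1/2) = G_((n+1)-1/2) *)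
      2%:R *: NSe (NSL (m + (n + 1)))
      + (if m + (n + 1) == 0 then 3%:R^-1 * (m * (m + 1))%:~R else 0) *: NSe NSC
  | NSC, _ | _, NSC => 0
  end.

(* The relations of U(NS). *)
Definition NSrel (x y : NSgen) : NST :=
  NSe x * NSe y - (-1) ^+ (NSpar x && NSpar y) *: (NSe y * NSe x)
  - NSbracket x y.

(* The basis of the subalgebra NS_+ := span (L_n, G_(n+1/2), C | n >= -1), and
   its character on the one-dimensional module F_c. *)
Definition NSstar (x : NSgen) : bool :=
  match x with NSL n => -1 <= n | NSG n => -1 <= n | NSC => true end.

Definition NSchar (c : F) (x : NSgen) : F := if x is NSC then c else 0.

(* U(NS) is the quotient of NST by the two-sided ideal spanned by the
   a * NSrel x y * b, and tensoring it over U(NS_+) with F_c divides out the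
   left ideal generated by the x - NSchar c x for x in NS_+. *)
Definition NSleft (c : F) : subspace NST :=
  span [set t | (exists a x y b, t = a * NSrel x y * b) \/
                (exists a x, NSstar x /\ t = a * (NSe x - NSchar c x *: 1))].

Definition VNS (c : F) : lmodType F := lquot (NSleft c).

Variable c : F.

(* t 1, for t in U(NS). *)
Definition VNScls (t : NST) : VNS c := cls (NSleft c) t.

Definition NSact (t : NST) (v : VNS c) : VNS c := VNScls (t * rep v).

Lemma NSleft_mul (a t : NST) : NSleft c t -> NSleft c (a * t).
Proof.
have sAr (b : NST) k s : b * (k *: s) = k *: (b * s).
  apply/malgP => w; rewrite mcoeffZ.
  rewrite (mcoeffMlw _ (finmap.fsubset_refl _) (msuppZ_le k s)) mcoeffMl mulr_sumr.
  apply: eq_bigr => w1 _; rewrite mulr_sumr; apply: eq_bigr => w2 _.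
  by rewrite mcoeffZ mulrnAr mulrCA.
move=> ht J hJ SJ; have [J0 JD] := hJ.
apply: (ht [set s | J (a * s)]).
  split=> [|k u v hu hv] /=; first by rewrite mulr0.
  by rewrite mulrDr sAr; apply: JD.
move=> s [[b [x [y [d ->]]]]|[b [x [hx ->]]]] /=; apply: SJ.
  by left; exists (a * b), x, y, d; rewrite !mulrA.
by right; exists (a * b), x; rewrite mulrA.
Qed.

Lemma NSactE (t s : NST) : NSact t (VNScls s) = VNScls (t * s).
Proof.
apply/cls_eqP; rewrite -mulrBr; apply: NSleft_mul; exact: cls_rep.
Qed.

Definition VNSpar (r : bool) : set (VNS c) :=
  VNScls @` span [set t | exists w : {fmonom NSgen},
                    odd (count NSpar w) = r /\ t = << w >>].

(* VNSdeg k is the component of degree k / 2. *)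
Definition VNSdeg (k : int) : set (VNS c) :=
  VNScls @` span [set t | exists w : {fmonom NSgen},
                    \sum_(x <- w) NSdeg x = k /\ t = << w >>].

(* A is the vertex superalgebra structure of V_NS(c,0). As L_(-2) 1 and
   G_(-3/2) 1 generate, at most one structure satisfies these conditions. *)
Definition is_VNS (A : vertex_superalgebra (VNS c)) : Prop :=
  [/\ vac A = VNScls 1,
      forall r, par A r = VNSpar r,
      forall m v, Y A (VNScls (NSe (NSL (-2)))) (m + 1) v = NSact (NSe (NSL m)) v &
      forall n v, Y A (VNScls (NSe (NSG (-2)))) (n + 1) v = NSact (NSe (NSG n)) v].

Variable A : vertex_superalgebra (VNS c).

Definition NS_I0 (p : nat) : ideal A :=
  gen_ideal A [set v | exists n : nat, (2 <= n)%N /\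
    v = VNScls (NSe (NSL (- n%:Z)) ^+ p
                - (if (p %| n)%N then NSe (NSL (- (n * p)%:Z)) else 0))].

Definition VNS0 (p : nat) : vertex_superalgebra (lquot (ideal_subspace (NS_I0 p))) :=
  quot_vsa (NS_I0 p).

Definition VNS0deg (p : nat) (k : int) : set (lquot (ideal_subspace (NS_I0 p))) :=
  cls (ideal_subspace (NS_I0 p)) @` VNSdeg k.

End NeveuSchwarz.

(* Main.v *)
From HB Require Import structures.
Require Import Defs.
From mathcomp Require Import all_boot all_order all_algebra.
From mathcomp Require Import boolp classical_sets functions cardinality fsbigop.
From mathcomp Require Import monalg zify ring.

Set Implicit Arguments.
Unset Strict Implicit.
Unset Printing Implicit Defensive.

Import Order.TTheory GRing.Theory Num.Theory.

(** Only an upper bound on the number of modules is needed, so it suffices to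
    attach to each irreducible N-graded twisted module one of [2 * p] labels in
    such a way that modules with a common label are isomorphic.

    Write [L_n] and [G_n] for the modes of the images of [L_(-2) 1] and
    [G_(-3/2) 1] on a twisted module [W]; both are indexed by integers [n], and
    they satisfy the commutation relations of the Ramond algebra, of which
    mostly the shape matters.  Two computations determine how [L_0] and [G_0]
    act on the lowest component [W_0].
    - [G_0 ^ 2 = L_0 + kappa] with a constant [kappa] that depends only on the
      algebra ([YW_G0_square]).
    - If [v] is an even vector of weight [d] on which [L_(-1)] is the
      translation operator, then the zero mode of [L_(-2) v] acts on [W_0] as
      the zero mode of [v] after [L_0 + d] ([YW_zero_mode]).  Hence the zero
      mode of [L_(-2)^p 1] is the product of the [L_0 + 2 j] for [j < p].  As
      [p] does not divide 2, the vector [L_(-2)^p 1] vanishes in the quotient,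
      so that [L_0] has an eigenvector in [W_0] with eigenvalue [- 2 j] for some
      [j < p] ([L0_eigenvector]).
    Therefore [G_0] has an eigenvector in [W_0] whose eigenvalue is one of the
    two square roots of [kappa - 2 j] ([lowest_weight_exists]): this gives the
    [2 * p] labels.

    Conversely, let [w1] and [w2] be lowest weight vectors with the same
    eigenvalues in two irreducible modules [W1] and [W2].  Let [N] be the span in
    the direct sum [W1 + W2] of what the modes of positive degree make of
    [(w1, w2)].  The commutation relations show that [N] is stable under all
    [L_n] and [G_n], hence under all modes ([span_raised_stable]), since a mode
    of [u_l v] is expressed through those of [u] and [v] by the Jacobi identity.
    In degree 0, [N] contains only the multiples of [(w1, w2)]
    ([raised_dsum]), so [N] contains neither summand and by irreducibility it is
    the graph of an isomorphism ([lowest_weight_iso]). *)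

(** * Subspaces, finitely supported sums and binomial coefficients *)

Section LinearAlgebra.
Local Open Scope classical_set_scope.
Local Open Scope ring_scope.
Variable F : fieldType.
Implicit Types U V : lmodType F.

Section Subspaces.
Variables (V : lmodType F) (S : set V).
Hypothesis hS : is_subspace S.

Lemma is_subspaceD u v : S u -> S v -> S (u + v).
Proof. by move=> hu hv; rewrite -[u]scale1r; apply: hS.2. Qed.

Lemma is_subspaceZ a u : S u -> S (a *: u).
Proof. by move=> hu; rewrite -[_ *: _]addr0; apply: hS.2 => //; exact: hS.1. Qed.

Lemma is_subspaceB u v : S u -> S v -> S (u - v).
Proof.
by move=> hu hv; apply: is_subspaceD => //; rewrite -scaleN1r; apply: is_subspaceZ.
Qed.

Lemma is_subspace_sum (I : Type) (r : seq I) (P : pred I) (f : I -> V) :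
  (forall i, S (f i)) -> S (\sum_(i <- r | P i) f i).
Proof.
move=> hf; elim/big_ind: _ => // [|u v]; first exact: hS.1.
exact: is_subspaceD.
Qed.

Lemma is_subspace_finsum (f : nat -> V) :
  (forall i, S (f i)) -> S (\sum_(i \in [set: nat]) f i).
Proof. by move=> hf; apply: is_subspace_sum. Qed.

End Subspaces.

Lemma span_min V (S J : set V) : is_subspace J -> S `<=` J -> span_set S `<=` J.
Proof. by move=> hJ SJ v; apply. Qed.

Lemma sub_span V (S : set V) : S `<=` span_set S.
Proof. by move=> v hv J _; apply. Qed.

Section LinearMaps.
Variables (U V : lmodType F) (f : U -> V).
Hypothesis hf : linear f.

Lemma linear_fun0 : f 0 = 0.
Proof. by have := hf (-1) 0 0; rewrite scaler0 addr0 scaleN1r addNr. Qed.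

Lemma linear_funZ a u : f (a *: u) = a *: f u.
Proof. by have := hf a u 0; rewrite linear_fun0 !addr0. Qed.

Lemma linear_funD u v : f (u + v) = f u + f v.
Proof. by have := hf 1 u v; rewrite !scale1r. Qed.

Lemma linear_fun_sum (I : Type) (r : seq I) (P : pred I) (g : I -> U) :
  f (\sum_(i <- r | P i) g i) = \sum_(i <- r | P i) f (g i).
Proof. exact: (big_morph f linear_funD linear_fun0). Qed.

Lemma preimage_is_subspace (S : set V) : is_subspace S -> is_subspace (f @^-1` S).
Proof.
move=> hS; split=> [|a u v] /=; first by rewrite linear_fun0; exact: hS.1.
by rewrite hf; apply: hS.2.
Qed.

Lemma linear_finsum (g : nat -> U) (N : nat) :
  (forall i, (N <= i)%N -> g i = 0) ->
  f (\sum_(i \in [set: nat]) g i) = \sum_(i \in [set: nat]) f (g i).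
Proof.
move=> hg; rewrite (finsum_trunc hg) (finsum_trunc (N := N)) ?linear_fun_sum //.
by move=> i /hg ->; rewrite linear_fun0.
Qed.

End LinearMaps.

Lemma binc0 (a : rat) : binc F a 0 = 1.
Proof. by rewrite /binc big_ord0 fact0 divr1 -[1]/(1%:R) ratr_nat. Qed.

Lemma binc1 (a : rat) : binc F a 1 = ratr a.
Proof. by rewrite /binc big_ord1 subr0 divr1. Qed.

Lemma binc0S (i : nat) : binc F 0 i.+1 = 0.
Proof. by rewrite /binc big_ord_recl subrr !mul0r -[0]/(0%:R) ratr_nat. Qed.

Lemma in_coset_add (r s : bool) (k : int) :
  in_coset (r (+) s) k -> in_coset s (k - r%:Z).
Proof. by rewrite /in_coset; case: r; case: s => /=; lia. Qed.

Lemma in_coset_bool (r : bool) : in_coset r r%:Z.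
Proof. by rewrite /in_coset; case: r. Qed.

Lemma in_cosetP (r : bool) (k : int) :
  reflect (exists j : int, k = j *+ 2 + r%:Z) (in_coset r k).
Proof.
rewrite /in_coset; apply: (iffP idP) => [h|[j ->]]; last by case: r; lia.
by exists (k %/ 2)%Z; case: r h; lia.
Qed.

End LinearAlgebra.

(** * Direct sums of twisted modules *)

Section DirectSum.
Local Open Scope classical_set_scope.
Local Open Scope ring_scope.
Variables (F : fieldType) (V : lmodType F) (B : vertex_superalgebra V).

Lemma Y_linear_trunc (u v : V) (l : int) :
  exists M : nat, forall i : nat, (M <= i)%N -> Y B u (l + i%:Z) v = 0.
Proof.
have [N hN] := Y_trunc B u v; have [M hM] := bound_nat N l.
by exists M => i /hM /hN.
Qed.

Lemma YW_trunc_nat (W : twisted_module B) (u : V) (w : W) (k : int) :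
  exists M : nat, forall i : nat, (M <= i)%N -> YW u (k + i%:Z *+ 2) w = 0.
Proof.
have [N hN] := YW_trunc u w; have [M hM] := bound_nat N k.
by exists M => i /hM h; apply: hN; lia.
Qed.

Lemma YW0l (W : twisted_module B) k (w : W) : YW (0 : V) k w = 0.
Proof. exact: (linear_fun0 (YW_linearl k w)). Qed.

Lemma YW0r (W : twisted_module B) (u : V) k : YW u k (0 : W) = 0.
Proof. exact: (linear_fun0 (YW_linearr u k)). Qed.

Variables W1 W2 : twisted_module B.

(** The modes act on a direct sum componentwise. *)
Definition dsum_YW (u : V) (k : int) (x : W1 * W2) : W1 * W2 :=
  (YW u k x.1, YW u k x.2).

Lemma dsum_linearl k w : linear (fun v => dsum_YW v k w).
Proof. by move=> a u v; rewrite /dsum_YW !YW_linearl. Qed.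

Lemma dsum_linearr v k : linear (dsum_YW v k).
Proof. by move=> a u w; rewrite /dsum_YW !YW_linearr. Qed.

Lemma dsum_coset r u : par B r u ->
  forall k w, ~~ in_coset r k -> dsum_YW u k w = 0.
Proof. by move=> hu k w hk; rewrite /dsum_YW !(YW_coset hu). Qed.

Lemma dsum_trunc u w : exists N : int, forall k, N <= k -> dsum_YW u k w = 0.
Proof.
have [N1 h1] := YW_trunc u w.1; have [N2 h2] := YW_trunc u w.2.
exists (Num.max N1 N2) => k; rewrite ge_max => /andP[/h1 e1 /h2 e2].
by rewrite /dsum_YW e1 e2.
Qed.

Lemma dsum_vac k w : dsum_YW (vac B) k w = if k == -2 then w else 0.
Proof. by rewrite /dsum_YW !YW_vac; case: w => x y; case: ifP. Qed.

Lemma dsum_jacobi r s u v : par B r u -> par B s v ->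
  forall w l m n, in_coset r m -> in_coset s n ->
  twisted_jacobi_coef (Y B) dsum_YW r s u v w l m n.
Proof.
move=> hu hv [w1 w2] l m n hm hn.
have E1 := YW_jacobi hu hv w1 l hm hn; have E2 := YW_jacobi hu hv w2 l hm hn.
have [M1 k1] := YW_trunc_nat v w1 n; have [M1' k1'] := YW_trunc_nat v w2 n.
have [M2 k2] := YW_trunc_nat u w1 m; have [M2' k2'] := YW_trunc_nat u w2 m.
have [M3 k3] := Y_linear_trunc u v l.
have lin1 : linear (fun x : W1 * W2 => x.1) by [].
have lin2 : linear (fun x : W1 * W2 => x.2) by [].
have t1 i : (maxn M1 M1' <= i)%N ->
    ((-1) ^+ i * binc F l%:~R i) *:
      dsum_YW u (m + l *+ 2 - i%:Z *+ 2) (dsum_YW v (n + i%:Z *+ 2) (w1, w2)) = 0.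
  rewrite geq_max => /andP[/k1 e /k1' e'].
  by rewrite /dsum_YW /= e e' !YW0r scaler0.
have t2 i : (maxn M2 M2' <= i)%N ->
    ((-1) ^ l * (-1) ^+ i * binc F l%:~R i) *:
      dsum_YW v (n + l *+ 2 - i%:Z *+ 2) (dsum_YW u (m + i%:Z *+ 2) (w1, w2)) = 0.
  rewrite geq_max => /andP[/k2 e /k2' e'].
  by rewrite /dsum_YW /= e e' !YW0r scaler0.
have t3 i : (M3 <= i)%N ->
    binc F (m%:~R / 2%:R) i *:
      dsum_YW (Y B u (l + i%:Z) v) (m + n - i%:Z *+ 2) (w1, w2) = 0.
  by move=> /k3 e; rewrite /dsum_YW /= e !YW0l scaler0.
have pairP (x y : W1 * W2) : x.1 = y.1 -> x.2 = y.2 -> x = y.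
  by case: x y => [? ?] [? ?] /= -> ->.
apply: pairP; rewrite /=.
  rewrite (linear_finsum lin1 t1) (linear_finsum lin1 t2) (linear_finsum lin1 t3).
  exact: E1.
rewrite (linear_finsum lin2 t1) (linear_finsum lin2 t2) (linear_finsum lin2 t3).
exact: E2.
Qed.

Definition dsum : twisted_module B :=
  TwistedModule dsum_linearl dsum_linearr dsum_coset dsum_trunc dsum_vac
    dsum_jacobi.

End DirectSum.

(** * Consequences of the twisted Jacobi identity *)

Section Modes.
Local Open Scope classical_set_scope.
Local Open Scope ring_scope.
Variables (F : fieldType) (V : lmodType F) (B : vertex_superalgebra V).
Variable W : twisted_module B.

Lemma YW_vac0 k (w : W) : k != -2 -> YW (vac B) k w = 0.
Proof. by rewrite YW_vac => /negbTE ->. Qed.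

Lemma finsum_binc0 (c : nat -> F) (f : nat -> W) :
  \sum_(i \in [set: nat]) (c i * binc F 0 i) *: f i = c 0%N *: f 0%N.
Proof.
rewrite (finsum_trunc (N := 1)); last first.
  by case=> // i _; rewrite binc0S mulr0 scale0r.
by rewrite big_ord1 binc0 mulr1.
Qed.

(** The Jacobi identity for [l = 0]. *)
Lemma YW_commutator r s u v (w : W) m n : par B r u -> par B s v ->
  in_coset r m -> in_coset s n ->
  YW u m (YW v n w) - (-1) ^+ (r && s) *: YW v n (YW u m w)
  = \sum_(i \in [set: nat])
       binc F (m%:~R / 2%:R) i *: YW (Y B u i%:Z v) (m + n - i%:Z *+ 2) w.
Proof.
move=> hu hv hm hn; have := YW_jacobi hu hv w 0 hm hn.
rewrite /twisted_jacobi_coef.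
rewrite mulr0z 2!finsum_binc0 expr0z expr0 mulr1 !scale1r.
rewrite !mul0rn !addr0 => ->.
by apply: eq_fsbigr => i _; rewrite add0r.
Qed.

(** [u_(-2) 1] is the derivative of [u]: the Jacobi identity for [u], the
    vacuum and [l = -2], where the left-hand side vanishes. *)
Lemma YW_derivative r u (w : W) m : par B r u -> in_coset r m ->
  YW (Y B u (-2) (vac B)) m w = - ratr (m%:~R / 2%:R) *: YW u (m - 2) w.
Proof.
move=> hu hm; have := YW_jacobi hu (vac_even B) w (-2) hm (isT : in_coset false 0).
rewrite /twisted_jacobi_coef.
rewrite fsbig1; last by move=> i _; rewrite YW_vac0 ?YW0r ?scaler0 //; lia.
rewrite fsbig1; last by move=> i _; rewrite YW_vac0 ?scaler0 //; lia.
rewrite scaler0 subr0 (finsum_trunc (N := 2)); last first.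
  move=> [|[|i]] // _; rewrite Y_creation0 ?YW0l ?scaler0 //; lia.
rewrite !big_ord_recl big_ord0 /= binc0 binc1 scale1r mul0rn !addr0.
rewrite (_ : -2 + (bump 0 0)%:Z = -1) // Y_creation1 => /esym/eqP.
by rewrite addr_eq0 scaleNr => /eqP.
Qed.

Variable S : set W.
Hypothesis hS : is_subspace S.

(** All modes of [v] preserve [S]. *)
Definition stabilizes (v : V) : Prop := forall k x, S x -> S (YW v k x).

Lemma stabilizes_is_subspace : is_subspace stabilizes.
Proof.
split=> [k x _|a u v hu hv k x hx]; first by rewrite YW0l; exact: hS.1.
by rewrite YW_linearl; apply: hS.2; [apply: hu | apply: hv].
Qed.

Lemma stabilizes_vac : stabilizes (vac B).
Proof. by move=> k x hx; rewrite YW_vac; case: ifP => // _; exact: hS.1. Qed.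

(** The Jacobi identity gives the modes of [u_l v] in terms of those of [u],
    of [v] and of [u_(l + i) v] for [i > 0]; as [u_l v = 0] for large [l], this
    is a descending induction on [l]. *)
Lemma stabilizes_Y r s u v l : par B r u -> par B s v ->
  stabilizes u -> stabilizes v -> stabilizes (Y B u l v).
Proof.
move=> hu hv Su Sv; have [N hN] := Y_trunc B u v.
suff H (d : nat) l' : N - d%:Z <= l' -> stabilizes (Y B u l' v).
  by apply: (H (`|N - l|)%N); lia.
elim: d l' => [|d IH] {}l hl k x hx.
  by rewrite hN ?YW0l; [exact: hS.1 | lia].
have [hk|hk] := boolP (in_coset (r (+) s) k); last first.
  by rewrite (YW_coset (Y_par l hu hv)) //; exact: hS.1.
have := YW_jacobi hu hv x l (in_coset_bool r) (in_coset_add hk).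
rewrite /twisted_jacobi_coef.
have [M hM] := Y_linear_trunc B u v l.
rewrite [X in _ = X](finsum_trunc (N := M.+1)); last first.
  by move=> i hi; rewrite hM ?YW0l ?scaler0 // ltnW.
rewrite big_ord_recl binc0 scale1r /= mul0rn !addr0 subrKC => E.
move/esym/eqP: E; rewrite eq_sym -subr_eq => /eqP <-.
apply: (is_subspaceB hS); last first.
  apply: (is_subspace_sum hS) => i; apply: (is_subspaceZ hS).
  by apply: IH => //; rewrite /bump; lia.
apply: (is_subspaceB hS); last apply: (is_subspaceZ hS);
  apply: (is_subspace_finsum hS) => i; apply: (is_subspaceZ hS).
  by apply/Su/Sv.
by apply/Sv/Su.
Qed.

End Modes.

(** * Algebras generated by a Neveu-Schwarz pair *)

Section Generators.
Local Open Scope classical_set_scope.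
Local Open Scope ring_scope.
Variables (F : fieldType) (V : lmodType F) (B : vertex_superalgebra V).

(** What is used of the Neveu-Schwarz vertex superalgebra: it is generated from
    the vacuum by an even vector [om] and an odd vector [tau], whose products
    [u_i v] for [i >= 0] are given up to the values of most coefficients.  Only
    the products [u_0 v] have to be known exactly. *)
Record NS_pair (om tau : V) : Prop := NSPair {
  ns_om : par B false om;
  ns_tau : par B true tau;
  ns_om_om0 : Y B om 0 om = Y B om (-2) (vac B);
  ns_om_omS : forall i : nat,
    exists a b, Y B om i.+1%:Z om = a *: om + b *: vac B;
  ns_om_tau0 : Y B om 0 tau = Y B tau (-2) (vac B);
  ns_om_tauS : forall i : nat, exists a, Y B om i.+1%:Z tau = a *: tau;
  ns_tau_tau0 : Y B tau 0 tau = 2%:R *: om;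
  ns_tau_tauS : forall i : nat, exists b, Y B tau i.+1%:Z tau = b *: vac B;
  ns_generate : forall P : set V, is_subspace P -> P (vac B) ->
    (forall r v n, par B r v -> P v -> P (Y B om n v)) ->
    (forall r v n, par B r v -> P v -> P (Y B tau n v)) ->
    forall v, P v }.

Variables (om tau : V).
Hypothesis hNS : NS_pair om tau.
Variable W : twisted_module B.

Lemma stabilizes_generators (S : set W) : is_subspace S ->
  stabilizes S om -> stabilizes S tau -> forall v, stabilizes S v.
Proof.
move=> hS hom htau v.
apply: (ns_generate hNS (P := stabilizes S)).
- exact: stabilizes_is_subspace.
- exact: stabilizes_vac.
- move=> r u n hu Su; exact: (stabilizes_Y hS n (ns_om hNS) hu).
- move=> r u n hu Su; exact: (stabilizes_Y hS n (ns_tau hNS) hu).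
Qed.

(** The commutators of modes of [om] and [tau] on a single vector [x]. *)
Section SingleVector.
Variables (S : set W) (x : W).
Hypothesis hS : is_subspace S.
Hypothesis Sx : S x.

(** The vectors all of whose modes send [x] into [S]. *)
Definition modes_in : set V := [set v | forall k, S (YW v k x)].

Lemma modes_in_is_subspace : is_subspace modes_in.
Proof.
split=> [k|a u v hu hv k]; first by rewrite YW0l; exact: hS.1.
by rewrite YW_linearl; apply: hS.2.
Qed.

Lemma modes_in_vac : modes_in (vac B).
Proof. by move=> k; rewrite YW_vac; case: ifP => // _; exact: hS.1. Qed.

Lemma modes_in_derivative r u : par B r u -> modes_in u ->
  modes_in (Y B u (-2) (vac B)).
Proof.
move=> hu hin k; have [hk|hk] := boolP (in_coset r k).
  by rewrite (YW_derivative _ hu) //; apply: (is_subspaceZ hS).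
have h := Y_par (-2) hu (vac_even B); rewrite addbF in h.
by rewrite (YW_coset h) //; exact: hS.1.
Qed.

Lemma commutator_in r s u v m n : par B r u -> par B s v ->
  in_coset r m -> in_coset s n ->
  (forall i : nat, modes_in (Y B u i%:Z v)) ->
  S (YW u m (YW v n x) - (-1) ^+ (r && s) *: YW v n (YW u m x)).
Proof.
move=> hu hv hm hn h; rewrite (YW_commutator _ hu hv) //.
apply: (is_subspace_finsum hS) => i; apply: (is_subspaceZ hS); exact: h.
Qed.

Lemma commutator_in_iff r s u v m n : par B r u -> par B s v ->
  in_coset r m -> in_coset s n ->
  (forall i : nat, modes_in (Y B u i%:Z v)) ->
  S (YW u m (YW v n x)) <-> S (YW v n (YW u m x)).
Proof.
move=> hu hv hm hn h; have C := commutator_in hu hv hm hn h.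
split=> [hA|hB]; last first.
  rewrite -[X in S X](subrK ((-1) ^+ (r && s) *: YW v n (YW u m x))).
  by apply: (is_subspaceD hS) => //; apply: (is_subspaceZ hS).
have {C} := is_subspaceZ hS ((-1) ^+ (r && s)) (is_subspaceB hS hA C).
by rewrite subKr scalerA -expr2 sqrr_sign scale1r.
Qed.

Hypotheses (om_in : modes_in om) (tau_in : modes_in tau).

Lemma modes_in_om_om (i : nat) : modes_in (Y B om i%:Z om).
Proof.
case: i => [|i].
  by rewrite (ns_om_om0 hNS); apply: modes_in_derivative (ns_om hNS) _.
have [a [b ->]] := ns_om_omS hNS i.
apply: (modes_in_is_subspace).2 => //.
exact/(is_subspaceZ modes_in_is_subspace)/modes_in_vac.
Qed.

Lemma modes_in_om_tau (i : nat) : modes_in (Y B om i%:Z tau).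
Proof.
case: i => [|i].
  by rewrite (ns_om_tau0 hNS); apply: modes_in_derivative (ns_tau hNS) _.
have [a ->] := ns_om_tauS hNS i.
exact: (is_subspaceZ modes_in_is_subspace).
Qed.

Lemma modes_in_tau_tau (i : nat) : modes_in (Y B tau i%:Z tau).
Proof.
case: i => [|i].
  by rewrite (ns_tau_tau0 hNS); apply: (is_subspaceZ modes_in_is_subspace).
have [b ->] := ns_tau_tauS hNS i.
exact/(is_subspaceZ modes_in_is_subspace)/modes_in_vac.
Qed.

End SingleVector.

(** The vectors obtained from [v] by modes of positive degree.  As [YW om k] is
    L_(k / 2 - 1) and [YW tau k] is G_((k - 1) / 2), which have degrees
    1 - k / 2 and (1 - k) / 2, these are the modes with [k < 2] and [k < 1]. *)
Inductive raised (v : W) : W -> Prop :=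
| Raised_start : raised v v
| Raised_om x k : raised v x -> k < 2 -> raised v (YW om k x)
| Raised_tau x k : raised v x -> k < 1 -> raised v (YW tau k x).

Section Raised.
Variable v : W.
Let N : set W := span_set (raised v).
Let hN : is_subspace N := span_is_subspace (raised v).

Lemma span_raised_om k x : k < 2 -> N x -> N (YW om k x).
Proof.
move=> hk; apply: (span_min (J := YW om k @^-1` N)).
  exact: (preimage_is_subspace (YW_linearr om k)).
by move=> y hy; apply: sub_span; apply: Raised_om.
Qed.

Lemma span_raised_tau k x : k < 1 -> N x -> N (YW tau k x).
Proof.
move=> hk; apply: (span_min (J := YW tau k @^-1` N)).
  exact: (preimage_is_subspace (YW_linearr tau k)).
by move=> y hy; apply: sub_span; apply: Raised_tau.
Qed.

(** The modes that do not raise the degree send [v] into [N]. *)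
Hypothesis om_v : forall k : int, 2 <= k -> N (YW om k v).
Hypothesis tau_v : forall k : int, 1 <= k -> N (YW tau k v).

(** Induction on [x]: a mode applied to [X x] is, up to sign and up to a
    commutator, [X] applied to a mode of [x]. *)
Lemma raised_modes x : raised v x -> modes_in N x om /\ modes_in N x tau.
Proof.
have [pom ptau] := (ns_om hNS, ns_tau hNS).
have reduce y r s u w k k0 : par B r u -> par B s w ->
    (in_coset r k -> in_coset s k0 -> N (YW u k (YW w k0 y))) ->
    N (YW u k (YW w k0 y)).
  move=> hu hw h; have [hk|hk] := boolP (in_coset r k); last first.
    by rewrite (YW_coset hu) //; exact: hN.1.
  have [hk0|hk0] := boolP (in_coset s k0); first exact: h.
  by rewrite (YW_coset hw) ?YW0r //; exact: hN.1.
elim=> {x} [|x k0 hx [IHom IHtau] hk0|x k0 hx [IHom IHtau] hk0].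
- split=> k; have Nv : N v by apply: sub_span; apply: Raised_start.
    by have [/om_v //|h] := leP 2 k; apply: span_raised_om.
  by have [/tau_v //|h] := leP 1 k; apply: span_raised_tau.
- have Nx : N x by apply: sub_span.
  split=> k; [apply: (reduce _ _ _ _ _ _ _ pom pom)
             |apply: (reduce _ _ _ _ _ _ _ ptau pom)] => h h0.
    apply/(commutator_in_iff hN pom pom h h0 (modes_in_om_om hN Nx IHom)).
    exact: span_raised_om.
  apply/(commutator_in_iff hN pom ptau h0 h (modes_in_om_tau hN IHtau)).
  exact: span_raised_om.
- have Nx : N x by apply: sub_span.
  split=> k; [apply: (reduce _ _ _ _ _ _ _ pom ptau)
             |apply: (reduce _ _ _ _ _ _ _ ptau ptau)] => h h0.
    apply/(commutator_in_iff hN pom ptau h h0 (modes_in_om_tau hN IHtau)).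
    exact: span_raised_tau.
  apply/(commutator_in_iff hN ptau ptau h h0 (modes_in_tau_tau hN Nx IHom)).
  exact: span_raised_tau.
Qed.

Lemma span_raised_stable u : stabilizes N u.
Proof.
apply: (stabilizes_generators hN) => k.
  apply: (span_min (J := YW om k @^-1` N)).
    exact: (preimage_is_subspace (YW_linearr om k)).
  by move=> y hy; have [+ _] := raised_modes hy; apply.
apply: (span_min (J := YW tau k @^-1` N)).
  exact: (preimage_is_subspace (YW_linearr tau k)).
by move=> y hy; have [_] := raised_modes hy; apply.
Qed.

End Raised.
End Generators.

(** * Lowest weight vectors determine irreducible modules *)

Section Isomorphism.
Local Open Scope classical_set_scope.
Local Open Scope ring_scope.
Variables (F : fieldType) (V : lmodType F) (B : vertex_superalgebra V).
Implicit Types W : twisted_module B.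

Lemma tm_iso_of_linear W1 W2 (f : W1 -> W2) : linear f -> bijective f ->
  (forall u k w, f (YW u k w) = YW u k (f w)) -> tm_iso W1 W2.
Proof.
move=> lf bf hf.
pose g : {linear W1 -> W2} := HB.pack f (GRing.isLinear.Build _ _ _ _ f lf).
by exists g.
Qed.

Lemma tm_iso_sym W1 W2 : tm_iso W1 W2 -> tm_iso W2 W1.
Proof.
case=> f [[g fK gK] hf]; apply: (@tm_iso_of_linear _ _ g).
- by move=> a u v; rewrite -{1}[u]gK -{1}[v]gK -linearP fK.
- by exists f.
- by move=> u k w; rewrite -{1}[w]gK -hf fK.
Qed.

(** A submodule of [W1 + W2] that is the graph of a bijection. *)
Lemma tm_iso_graph W1 W2 (S : set (dsum W1 W2)) : is_subspace S ->
  (forall u, stabilizes S u) ->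
  (forall x, exists y, S (x, y)) -> (forall y, exists x, S (x, y)) ->
  (forall x, S (x, 0) -> x = 0) -> (forall y, S (0, y) -> y = 0) ->
  tm_iso W1 W2.
Proof.
move=> hS Sst /choice[f hf] /choice[g hg] inj1 inj2.
have uniq2 x y y' : S (x, y) -> S (x, y') -> y = y'.
  move=> h h'; apply/eqP; rewrite -subr_eq0; apply/eqP/inj2.
  by have := is_subspaceB hS h h'; rewrite -[_ - _]/(x - x, y - y') subrr.
have uniq1 x x' y : S (x, y) -> S (x', y) -> x = x'.
  move=> h h'; apply/eqP; rewrite -subr_eq0; apply/eqP/inj1.
  by have := is_subspaceB hS h h'; rewrite -[_ - _]/(x - x', y - y) subrr.
apply: (@tm_iso_of_linear _ _ f).
- move=> a u v; apply: (uniq2 (a *: u + v)) => //.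
  exact: (hS.2 a (u, f u) (v, f v)).
- exists g => x; first exact: (uniq1 _ _ (f x)).
  exact: (uniq2 (g x)).
- by move=> u k w; apply: (uniq2 (YW u k w)) => //; apply: (Sst u k (w, f w)).
Qed.

Section Graded.
Variables (deg : int -> set V) (W : twisted_module B) (gr : nat -> set W).

(** The condition on the modes in the definition of an N-grading. *)
Definition gr_action : Prop :=
  forall (q k : int) (r : nat) u w, deg q u -> gr r w ->
    let t := r%:Z *+ 2 + q - k - 2 in
    (forall j : nat, t = j%:Z *+ 2 -> gr j (YW u k w)) /\
    ((forall j : nat, t <> j%:Z *+ 2) -> YW u k w = 0).

Hypotheses (hgr : direct_sum_decomposition gr) (hact : gr_action).

(** The sum of the components of positive degree. *)
Definition gr_pos : set W := span_set [set w | exists n : nat, gr n.+1 w].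

Lemma gr_pos_is_subspace : is_subspace gr_pos.
Proof. exact: span_is_subspace. Qed.

Lemma gr_lower q k u w : deg q u -> gr 0%N w -> q - 2 < k -> YW u k w = 0.
Proof. by move=> hu hw hk; apply: (hact k hu hw).2 => j; lia. Qed.

Lemma gr_zero_mode q u w : deg q u -> gr 0%N w -> gr 0%N (YW u (q - 2) w).
Proof. by move=> hu hw; apply: (hact _ hu hw).1; lia. Qed.

Lemma gr_raise q k u w : deg q u -> k < q - 2 -> gr_pos (YW u k w).
Proof.
move=> hu hk; have [_ + _] := hgr => /(_ w)[M [f [hf ->]]].
rewrite (linear_fun_sum (YW_linearr u k)).
apply: (is_subspace_sum gr_pos_is_subspace) => n.
have [h0 h1] := hact k hu (hf n).
have [[j hj]|H] := pselect (exists j : nat,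
    n%:Z *+ 2 + q - k - 2 = j%:Z *+ 2); last first.
  by rewrite h1 => [|j hj]; [exact: gr_pos_is_subspace.1 | apply: H; exists j].
case: j hj => [|j] hj; first by lia.
by apply: sub_span; exists j; apply: h0.
Qed.

Lemma gr_pos0 w : gr_pos w -> gr 0%N w -> w = 0.
Proof.
have [hs _ hdir] := hgr.
pose J := [set x : W | exists N (f : nat -> W), [/\ forall n, gr n (f n), f 0%N = 0,
  forall n, (N <= n)%N -> f n = 0 & x = \sum_(n < N) f n]].
have ext M N (f : nat -> W) : (N <= M)%N -> (forall n, (N <= n)%N -> f n = 0) ->
    \sum_(n < M) f n = \sum_(n < N) f n.
  move=> le hf; rewrite -(subnKC le) big_split_ord /= [X in _ + X]big1 ?addr0 //.
  by move=> i _; rewrite hf // leq_addr.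
have hJ : is_subspace J.
  split=> [|a u v [N [f [hf f0 fN ->]]] [M [g [hg g0 gM ->]]]].
    exists 0%N, (fun=> 0); split=> // [n|]; first exact: (hs n).1.
    by rewrite big_ord0.
  exists (maxn N M), (fun n => a *: f n + g n); split.
  - by move=> n; apply: (hs n).2.
  - by rewrite f0 g0 scaler0 addr0.
  - by move=> n; rewrite geq_max => /andP[/fN -> /gM ->]; rewrite scaler0 addr0.
  - rewrite big_split /= -scaler_sumr.
    rewrite (ext (maxn N M) N f (leq_maxl _ _) fN).
    by rewrite (ext (maxn N M) M g (leq_maxr _ _) gM).
move=> /(_ J hJ) hin hw; case: hin => [x [n hx]|N [f [hf f0 fN wE]]].
  exists n.+2, (fun m => if m == n.+1 then x else 0); split=> //.
  - by move=> m; case: eqP => [->|_] //; exact: (hs m).1.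
  - by move=> m hm; rewrite gtn_eqF.
  - rewrite (bigD1 ord_max) //= eqxx big1 ?addr0 // => i.
    by rewrite -val_eqE /= => /negbTE ->.
(* Subtracting w, as a term of degree 0, gives a relation among the gr n. *)
pose g n := if n == 0%N then - w else f n.
have hg n : gr n (g n).
  rewrite /g; case: eqP => [->|_] //.
  by rewrite -scaleN1r; apply: (is_subspaceZ (hs 0%N)).
have g0 : \sum_(n < N.+1) g n = 0.
  rewrite big_ord_recl /= {1}/g /= [in - w]wE -[in X in - X](ext N.+1) //.
  by rewrite [in X in - X]big_ord_recl /= f0 add0r addNr.
have := hdir _ _ hg g0 0%N isT; rewrite /g /= => /eqP.
by rewrite oppr_eq0 => /eqP.
Qed.

End Graded.
Section LowestWeight.
Variables (om tau : V) (deg : int -> set V).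
Hypotheses (hNS : NS_pair B om tau) (deg_om : deg 4 om) (deg_tau : deg 3 tau).

(** A nonzero vector of degree 0 on which L_0 and G_0 act by the scalars [lam]
    and [mu]. *)
Definition lowest_weight W (gr : nat -> set W) (lam mu : F) (w : W) : Prop :=
  [/\ gr 0%N w, w <> 0, YW om 2 w = lam *: w & YW tau 1 w = mu *: w].

(** The span of the raised vectors consists of multiples of [(w1, w2)] up to
    terms of positive degree. *)
Lemma raised_dsum W1 W2 (gr1 : nat -> set W1) (gr2 : nat -> set W2)
    (w1 : W1) (w2 : W2) :
  direct_sum_decomposition gr1 -> gr_action deg gr1 ->
  direct_sum_decomposition gr2 -> gr_action deg gr2 ->
  forall x : dsum W1 W2, span_set (raised om tau (W := dsum W1 W2) (w1, w2)) x ->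
  exists a, gr_pos gr1 (x.1 - a *: w1) /\ gr_pos gr2 (x.2 - a *: w2).
Proof.
move=> d1 a1 d2 a2; have [p1 p2] := (gr_pos_is_subspace gr1, gr_pos_is_subspace gr2).
apply: span_min.
  split=> [|a x y [b [hb1 hb2]] [c [hc1 hc2]]].
    by exists 0; rewrite !scale0r !subr0; split; [exact: p1.1 | exact: p2.1].
  have E (U : lmodType F) (u u' t : U) :
      a *: u + u' - (a * b + c) *: t = a *: (u - b *: t) + (u' - c *: t).
    by rewrite scalerDl -scalerA opprD addrACA -scalerBr.
  exists (a * b + c); rewrite -[(_ + _).1]/(a *: x.1 + y.1).
  rewrite -[(_ + _).2]/(a *: x.2 + y.2) !E.
  by split; [apply: p1.2 | apply: p2.2].
have raise (u : V) q k (x : dsum W1 W2) : deg q u -> k < q - 2 ->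
    exists a, gr_pos gr1 ((YW u k x).1 - a *: w1) /\
              gr_pos gr2 ((YW u k x).2 - a *: w2).
  move=> hu hk; exists 0; rewrite !scale0r !subr0.
  by split; [apply: (gr_raise d1 a1 _ hu) | apply: (gr_raise d2 a2 _ hu)].
move=> x; elim=> {x} [|x k _ _ hk|x k _ _ hk].
- by exists 1; rewrite !scale1r !subrr; split; [exact: p1.1 | exact: p2.1].
- by apply: (raise _ 4).
- by apply: (raise _ 3).
Qed.

Lemma lowest_weight_iso W1 W2 (gr1 : nat -> set W1) (gr2 : nat -> set W2)
    (lam mu : F) (w1 : W1) (w2 : W2) :
  tm_irreducible W1 -> direct_sum_decomposition gr1 -> gr_action deg gr1 ->
  tm_irreducible W2 -> direct_sum_decomposition gr2 -> gr_action deg gr2 ->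
  lowest_weight gr1 lam mu w1 -> lowest_weight gr2 lam mu w2 -> tm_iso W1 W2.
Proof.
move=> [_ irr1] d1 a1 [_ irr2] d2 a2 [g1 n1 o1 t1] [g2 n2 o2 t2].
pose v : dsum W1 W2 := (w1, w2); pose S := span_set (raised om tau v).
have hS : is_subspace S := span_is_subspace _.
have Sv : S v by apply: sub_span; apply: Raised_start.
have Sst u : stabilizes S u.
  apply: (span_raised_stable hNS) => k hk.
    have [->|k2] := eqVneq k 2.
      rewrite [YW _ _ _](_ : _ = lam *: v); first exact: (is_subspaceZ hS).
      by rewrite -[LHS]/(YW om 2 w1, YW om 2 w2) o1 o2.
    rewrite [YW _ _ _](_ : _ = 0); first exact: hS.1.
    rewrite -[LHS]/(YW om k w1, YW om k w2).
    by rewrite (gr_lower a1 deg_om g1) ?(gr_lower a2 deg_om g2) //; lia.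
  have [->|k1] := eqVneq k 1.
    rewrite [YW _ _ _](_ : _ = mu *: v); first exact: (is_subspaceZ hS).
    by rewrite -[LHS]/(YW tau 1 w1, YW tau 1 w2) t1 t2.
  rewrite [YW _ _ _](_ : _ = 0); first exact: hS.1.
  rewrite -[LHS]/(YW tau k w1, YW tau k w2).
  by rewrite (gr_lower a1 deg_tau g1) ?(gr_lower a2 deg_tau g2) //; lia.
have S0 (x : dsum W1 W2) : S x -> gr1 0%N x.1 -> gr2 0%N x.2 ->
    exists a, x = a *: v.
  move=> /(raised_dsum d1 a1 d2 a2)[a [h1 h2]] hx1 hx2; exists a.
  have e1 : x.1 - a *: w1 = 0.
    apply: (gr_pos0 d1 h1); have [hs _ _] := d1.
    by apply: (is_subspaceB (hs 0%N)) => //; apply: (is_subspaceZ (hs 0%N)).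
  have e2 : x.2 - a *: w2 = 0.
    apply: (gr_pos0 d2 h2); have [hs _ _] := d2.
    by apply: (is_subspaceB (hs 0%N)) => //; apply: (is_subspaceZ (hs 0%N)).
  move/eqP: e1; move/eqP: e2; rewrite !subr_eq0 => /eqP e2 /eqP e1.
  by case: x e1 e2 {hx1 hx2 h1 h2} => /= x1 x2 -> ->.
have [[hz1 _ _] [hz2 _ _]] := (d1, d2).
apply: (tm_iso_graph hS Sst) => [x|y|x hx|y hy].
- have [] := irr1 [set x | exists y, S (x, y)].
  + split=> [|a x1 x2 [y1 h1] [y2 h2]]; first by exists 0; exact: hS.1.
    by exists (a *: y1 + y2); apply: (hS.2 a (x1, y1) (x2, y2)).
  + by move=> u k x1 [y1 h1]; exists (YW u k y1); apply: (Sst u k (x1, y1)).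
  + move=> E; have : [set x | exists y, S (x, y)] w1 by exists w2.
    by rewrite E.
  + by move=> E; have : [set: W1] x by []; rewrite -E.
- have [] := irr2 [set y | exists x, S (x, y)].
  + split=> [|a y1 y2 [x1 h1] [x2 h2]]; first by exists 0; exact: hS.1.
    by exists (a *: x1 + x2); apply: (hS.2 a (x1, y1) (x2, y2)).
  + by move=> u k y1 [x1 h1]; exists (YW u k x1); apply: (Sst u k (x1, y1)).
  + move=> E; have : [set y | exists x, S (x, y)] w2 by exists w1.
    by rewrite E.
  + by move=> E; have : [set: W2] y by []; rewrite -E.
- have [||E|E] := irr1 [set x | S (x, 0)].
  + split=> [|a x1 x2 h1 h2]; first exact: hS.1.
    by have := hS.2 a _ _ h1 h2; rewrite -[_ + _]/(_, _) /= scaler0 addr0.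
  + by move=> u k x1 /(Sst u k); rewrite -[YW _ _ _]/(YW u k x1, YW u k 0) YW0r.
  + by have : [set x | S (x, 0)] x by []; rewrite E.
  + have : [set x | S (x, 0)] w1 by rewrite E.
    move=> /S0 /= []; [by [] | exact: (hz2 0%N).1 | move=> a].
    move=> [e /esym/eqP]; rewrite scaler_eq0 => /orP[/eqP a0|/eqP //].
    by case: n1; rewrite e a0 scale0r.
- have [||E|E] := irr2 [set y | S (0, y)].
  + split=> [|a x1 x2 h1 h2]; first exact: hS.1.
    by have := hS.2 a _ _ h1 h2; rewrite -[_ + _]/(_, _) /= scaler0 addr0.
  + by move=> u k x1 /(Sst u k); rewrite -[YW _ _ _]/(YW u k 0, YW u k x1) YW0r.
  + by have : [set y | S (0, y)] y by []; rewrite E.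
  + have : [set y | S (0, y)] w2 by rewrite E.
    move=> /S0 /= []; [exact: (hz1 0%N).1 | by [] | move=> a].
    move=> [/esym/eqP + e]; rewrite scaler_eq0 => /orP[/eqP a0|/eqP //].
    by case: n2; rewrite e a0 scale0r.
Qed.

End LowestWeight.
End Isomorphism.

(** * The action of L_0 and G_0 on the lowest component *)

Section ZeroModes.
Local Open Scope classical_set_scope.
Local Open Scope ring_scope.
Variables (F : fieldType) (V : lmodType F) (B : vertex_superalgebra V).
Variables (om tau : V) (deg : int -> set V).
Hypotheses (hNS : NS_pair B om tau) (deg_om : deg 4 om) (deg_tau : deg 3 tau).
Implicit Types W : twisted_module B.

(** [G_0 ^ 2 = L_0 + kappa / 2].  Of the terms [tau_i tau] with [i > 0], all of
    them multiples of the vacuum, only [i = 2] contributes. *)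
Lemma YW_G0_square : exists kappa : F, forall W (w : W),
  2%:R *: YW tau 1 (YW tau 1 w) = 2%:R *: YW om 2 w + kappa *: w.
Proof.
have [b1 e1] := ns_tau_tauS hNS 0; have [b2 e2] := ns_tau_tauS hNS 1.
exists (binc F (1%:~R / 2%:R) 2 * b2) => W w.
have := YW_commutator w (ns_tau hNS) (ns_tau hNS) (isT : in_coset true 1)
  (isT : in_coset true 1).
rewrite expr1 scaleN1r opprK -mulr2n -scaler_nat => ->.
rewrite (finsum_trunc (N := 3)); last first.
  case=> // i hi; have [b ->] := ns_tau_tauS hNS i.
  rewrite (linear_funZ (YW_linearl _ w)) YW_vac0 ?scaler0 //; lia.
rewrite !big_ord_recl big_ord0 /= binc0 scale1r (ns_tau_tau0 hNS) mul0rn !addr0.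
rewrite (linear_funZ (YW_linearl _ w)) e1 e2.
rewrite !(linear_funZ (YW_linearl _ w)) YW_vac0 // !scaler0 add0r.
by rewrite YW_vac scalerA.
Qed.

(** [L_(-1)] acts on [v] as the translation operator, which sends [v] to
    [v_(-2) 1]. *)
Definition translates (v : V) : Prop := Y B om 0 v = Y B v (-2) (vac B).

Lemma Y_derivative r u (w : V) : par B r u ->
  Y B (Y B u (-2) (vac B)) (-1) w = Y B u (-2) w.
Proof.
move=> hu; have := Y_jacobi hu (vac_even B) w (-2) (-1) 0; rewrite /jacobi_coef.
have vac0 k (x : V) : k != -1 -> Y B (vac B) k x = 0.
  by rewrite Y_vac => /negbTE ->.
rewrite fsbig1; last by move=> i _; rewrite vac0 ?Y0r ?scaler0 //; lia.
rewrite fsbig1; last by move=> i _; rewrite vac0 ?scaler0 //; lia.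
rewrite scaler0 subr0 (finsum_trunc (N := 2)); last first.
  move=> [|[|i]] // _; rewrite Y_creation0 ?Y0l ?scaler0 //; lia.
rewrite !big_ord_recl big_ord0 /= binc0 binc1 scale1r !addr0 ratr_int.
rewrite (_ : -2 + (bump 0 0)%:Z = -1) // Y_creation1 => /esym/eqP.
by rewrite scaleN1r subr_eq0 => /eqP.
Qed.

Lemma finsum_V_binc0 (c : nat -> F) (f : nat -> V) :
  \sum_(i \in [set: nat]) (c i * binc F 0 i) *: f i = c 0%N *: f 0%N.
Proof.
rewrite (finsum_trunc (N := 1)); last first.
  by case=> // i _; rewrite binc0S mulr0 scale0r.
by rewrite big_ord1 binc0 mulr1.
Qed.

(** Both the translation operator and [L_(-1)] satisfy the Leibniz rule for
    [om_(-1) v]. *)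
Lemma translates_om v : par B false v -> translates v ->
  translates (Y B om (-1) v).
Proof.
move=> hv tv; have hom := ns_om hNS; rewrite /translates.
have E0 : Y B om 0 (Y B om (-1) v) - Y B om (-1) (Y B om 0 v) = Y B om (-2) v.
  have := Y_jacobi hom hom v 0 0 (-1).
  rewrite /jacobi_coef mulr0z 2!finsum_V_binc0 !expr0 !mulr1 !scale1r.
  rewrite (finsum_trunc (N := 1)); last first.
    by case=> // i _; rewrite binc0S scale0r.
  rewrite big_ord1 binc0 scale1r !addr0 => ->.
  by rewrite (ns_om_om0 hNS) (Y_derivative _ hom).
have E1 : Y B (Y B om (-1) v) (-2) (vac B)
    = Y B om (-1) (Y B v (-2) (vac B)) + Y B om (-2) v.
  have := Y_jacobi hom hv (vac B) (-1) 0 (-2); rewrite /jacobi_coef.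
  rewrite mulr0z [RHS](finsum_trunc (N := 1)); last first.
    by case=> // i _; rewrite binc0S scale0r.
  rewrite big_ord1 binc0 scale1r !addr0 !add0r => <-.
  rewrite [X in _ - _ *: X]fsbig1; last first.
    by move=> i _; rewrite Y_creation0 ?Y0r ?scaler0 //; lia.
  rewrite scaler0 subr0 (finsum_trunc (N := 2)); last first.
    by move=> [|[|i]] // _; rewrite Y_creation0 ?Y0r ?scaler0 //; lia.
  rewrite !big_ord_recl big_ord0 /= binc0 binc1 ratr_int !addr0.
  rewrite expr0 mulr1 expr1 mulrNN mulr1 !scale1r.
  by rewrite (_ : -2 + (bump 0 0)%:Z = -1) // Y_creation1.
by rewrite E1 -tv -E0 addrC subrK.
Qed.

(** The Jacobi identity for [om], [v] and [l = -1].  On [w] only two terms of it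
    survive: [v_d L_(-1) w], which is [d v_(d-1) w], and [v_(d-1) L_0 w]. *)
Lemma YW_zero_mode W (gr : nat -> set W) (d : nat) v w :
  gr_action deg gr -> par B false v -> deg (d%:Z *+ 2) v -> translates v ->
  gr 0%N w ->
  YW (Y B om (-1) v) (d%:Z *+ 2 + 2) w
    = YW v (d%:Z *+ 2 - 2) (YW om 2 w + d%:R *: w).
Proof.
move=> hact hv dv tv hw; have hom := ns_om hNS; set q := d%:Z *+ 2 in dv *.
have cq k : in_coset false (q + k *+ 2).
  by apply/in_cosetP; exists (d%:Z + k); rewrite /q; lia.
have cq0 : in_coset false q by have := cq 0; rewrite mul0rn addr0.
have E : YW v q (YW om 0 w) = d%:R *: YW v (q - 2) w.
  have := YW_commutator w hom hv (isT : in_coset false 0) (cq 0).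
  rewrite mul0rn addr0 expr0 scale1r (gr_lower hact dv hw); last by lia.
  rewrite YW0r sub0r mulr0z mul0r (finsum_trunc (N := 1)); last first.
    by case=> // i _; rewrite binc0S scale0r.
  rewrite big_ord1 binc0 scale1r tv (YW_derivative _ hv) mul0rn ?subr0 ?add0r //.
  have -> : q%:~R / 2%:R = d%:Z%:~R :> rat.
    by rewrite /q rmorphMn /= -[_ *+ 2]mulr_natr mulfK.
  by rewrite ratr_int scaleNr => /oppr_inj.
have := YW_jacobi hom hv w (-1) (isT : in_coset false 0) (cq 1).
rewrite /twisted_jacobi_coef.
rewrite fsbig1; last first.
  move=> i _; rewrite (gr_lower hact dv hw) ?YW0r ?scaler0 //; lia.
rewrite (finsum_trunc (N := 2)); last first.
  move=> [|[|i]] // _; rewrite (gr_lower hact deg_om hw) ?YW0r ?scaler0 //; lia.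
rewrite mulr0z mul0r [in RHS](finsum_trunc (N := 1)); last first.
  by case=> // i _; rewrite binc0S scale0r.
rewrite big_ord1 !big_ord_recl big_ord0 /= !binc0 binc1 ratr_int.
rewrite (_ : q + 2 + -1 *+ 2 - Posz 0 *+ 2 = q); last by lia.
rewrite (_ : q + 2 + -1 *+ 2 - Posz (bump 0 0) *+ 2 = q - 2); last first.
  by rewrite /bump; lia.
rewrite (_ : 0 + Posz 0 *+ 2 = 0) // (_ : 0 + Posz (bump 0 0) *+ 2 = 2) //.
rewrite (_ : 0 + (q + 2) - Posz 0 *+ 2 = q + 2); last by lia.
rewrite (_ : -1 + Posz 0 = -1) // E !scale1r exprN1 invrN1.
rewrite !expr0 expr1 addr0 => <-.
rewrite (linear_funD (YW_linearr _ _)) (linear_funZ (YW_linearr _ _)).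
rewrite sub0r mulrN1z mulrNN !mulr1 mul1r !scaleN1r.
by rewrite opprD !opprK addrC.
Qed.

(** The vector [L_(-2)^k 1]. *)
Definition om_power (k : nat) : V := iter k (Y B om (-1)) (vac B).

Lemma om_power_even k : par B false (om_power k).
Proof.
elim: k => [|k IH]; first exact: vac_even.
exact: (Y_par (-1) (ns_om hNS) IH).
Qed.

Lemma om_power_translates k : translates (om_power k).
Proof.
elim: k => [|k IH]; last exact: translates_om (om_power_even k) IH.
by rewrite /translates /om_power /= Y_creation0 // Y_vac.
Qed.

Hypothesis deg_om_power : forall k, deg (k%:Z *+ 4) (om_power k).

Lemma L0_eigenvector W (gr : nat -> set W) (k : nat) w :
  direct_sum_decomposition gr -> gr_action deg gr -> gr 0%N w -> w <> 0 ->
  YW (om_power k) (k%:Z *+ 4 - 2) w = 0 ->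
  exists j w', [/\ (j < k)%N, gr 0%N w', w' <> 0 &
                   YW om 2 w' = - j.*2%:R *: w'].
Proof.
move=> [hs _ _] hact; elim: k w => [|k IH] w hw nw.
  by rewrite YW_vac => /nw.
have e4 i : i%:Z *+ 4 = i.*2%:Z *+ 2 by lia.
rewrite (_ : k.+1%:Z *+ 4 - 2 = k.*2%:Z *+ 2 + 2); last by lia.
rewrite [om_power _]/(Y B om (-1) (om_power k)).
rewrite (YW_zero_mode hact (om_power_even k) _ (om_power_translates k) hw); last first.
  by rewrite -e4.
rewrite -e4; set w1 := YW om 2 w + _ => h0.
have [w10|/eqP w1n] := eqVneq w1 0.
  exists k, w; split=> //; apply/eqP.
  by rewrite scaleNr -addr_eq0; apply/eqP.
have hw1 : gr 0%N w1.
  apply: (is_subspaceD (hs 0%N)); last exact: (is_subspaceZ (hs 0%N)).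
  exact: (gr_zero_mode hact deg_om hw).
have [j [w' [hj h1 h2 h3]]] := IH w1 hw1 w1n h0.
by exists j, w'; split=> //; apply: ltnW.
Qed.

(** If [w] is an eigenvector of [L_0] and [s j ^ 2] the eigenvalue of [G_0 ^ 2]
    on it, then [(G_0 - s j) (G_0 + s j) w = 0]: either [w] or [(G_0 + s j) w] is
    an eigenvector of [G_0]. *)
Lemma lowest_weight_exists W (gr : nat -> set W) (kappa : F) (p : nat)
    (s : nat -> F) :
  2%:R != 0 :> F -> (forall j, s j ^+ 2 = kappa - j.*2%:R) ->
  (forall w : W, YW tau 1 (YW tau 1 w) = YW om 2 w + kappa *: w) ->
  om_power p = 0 ->
  direct_sum_decomposition gr -> gr_action deg gr ->
  (exists2 w, gr 0%N w & w <> 0) ->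
  exists (j : 'I_p) (b : bool) w,
    lowest_weight om tau gr (- j.*2%:R) ((-1) ^+ b * s j) w.
Proof.
move=> n2 hs hG hp hdec hact [w0 hw0 nw0].
have [|j [w [hj hw nw hL]]] := L0_eigenvector (k := p) hdec hact hw0 nw0.
  by rewrite hp YW0l.
have [hsub _ _] := hdec; have sub0 := hsub 0%N.
have hG2 : YW tau 1 (YW tau 1 w) = s j ^+ 2 *: w.
  by rewrite hG hL hs -scalerDl addrC.
exists (Ordinal hj); set x := YW tau 1 w + s j *: w.
have [x0|/eqP xn] := eqVneq x 0.
  exists true, w; split=> //=; rewrite expr1 mulN1r scaleNr; apply/eqP.
  by rewrite -addr_eq0; apply/eqP.
have hx : YW tau 1 x = s j *: x.
  rewrite /x (linear_funD (YW_linearr _ _)) (linear_funZ (YW_linearr _ _)).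
  by rewrite hG2 scalerDr scalerA -expr2 addrC.
exists false, x; split=> //=; last by rewrite mul1r.
  apply: (is_subspaceD sub0); last exact: (is_subspaceZ sub0).
  exact: (gr_zero_mode hact deg_tau hw).
have := hG x; rewrite hx (linear_funZ (YW_linearr _ _)) hx scalerA -expr2 hs.
by rewrite scalerDl [RHS]addrC => /addrI <-.
Qed.

End ZeroModes.

(** * The Neveu-Schwarz vertex superalgebra and its quotient *)

Section QuotientPair.
Local Open Scope classical_set_scope.
Local Open Scope ring_scope.
Variables (F : fieldType) (V : lmodType F) (A : vertex_superalgebra V) (J : ideal A).
Local Notation pi := (cls (ideal_subspace J)).

Lemma NS_pair_quot om tau : NS_pair A om tau -> NS_pair (quot_vsa J) (pi om) (pi tau).
Proof.
move=> h.
have hY u n v : Y (quot_vsa J) (pi u) n (pi v) = pi (Y A u n v) by exact: quot_YE.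
have hv : vac (quot_vsa J) = pi (vac A) by [].
split; rewrite ?hv ?hY.
- by exists om => //; exact: ns_om h.
- by exists tau => //; exact: ns_tau h.
- by rewrite (ns_om_om0 h).
- move=> i; have [a [b e]] := ns_om_omS h i; exists a, b.
  by rewrite hY e linearD !linearZ.
- by rewrite (ns_om_tau0 h).
- by move=> i; have [a e] := ns_om_tauS h i; exists a; rewrite hY e linearZ.
- by rewrite (ns_tau_tau0 h) linearZ.
- by move=> i; have [b e] := ns_tau_tauS h i; exists b; rewrite hY e linearZ.
- move=> P hP Pvac Pom Ptau q; rewrite -[q]repK.
  apply: (ns_generate h (P := pi @^-1` P)) => //.
  + exact: (preimage_is_subspace (cls_is_linear (ideal_subspace J)) hP).
  + move=> r v n hr Pv; rewrite /preimage /= -hY; apply: (Pom r) => //.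
    by exists v.
  + move=> r v n hr Pv; rewrite /preimage /= -hY; apply: (Ptau r) => //.
    by exists v.
Qed.

Lemma om_power_quot om k : om_power (quot_vsa J) (pi om) k = pi (om_power A om k).
Proof.
elim: k => // k IH; rewrite /om_power !iterS -!/(om_power _ _ _) IH.
exact: quot_YE.
Qed.

End QuotientPair.

(** Identities in an algebra, stated abstractly so that the multiplication of the
    tensor algebra is never unfolded when they are used. *)
Section SuperCommutator.
Local Open Scope ring_scope.
Variables (R : nzRingType) (L : lalgType R) (k : R) (x y b t : L).

Lemma super_commutator_mulr :
  x * (y * t) - (k *: (y * (x * t)) + b * t)
  = 1 * (x * y - k *: (y * x) - b) * t.
Proof. by rewrite mul1r !mulrA !mulrBl scalerAl opprD addrA. Qed.

Lemma super_commutator_mulr1 :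
  x * y - (k *: (y * x) + b) = 1 * (x * y - k *: (y * x) - b) * 1.
Proof. by rewrite mul1r mulr1 opprD addrA. Qed.

Lemma lalg_combination_mul (k' : R) :
  (k *: x + k' *: y) * t = k *: (x * t) + k' *: (y * t).
Proof. by rewrite mulrDl !scalerAl. Qed.

End SuperCommutator.

Lemma is_subspace_solve (F : fieldType) (V : lmodType F) (S : set V)
    (a b k : F) (u v w z : V) :
  is_subspace S -> k != 0%R -> u = (a *: v + (b *: w + k *: z))%R ->
  S u -> S v -> S w -> S z.
Proof.
move=> hS k0 -> hu hv hw; rewrite -[z](scalerK k0); apply: (is_subspaceZ hS).
rewrite -[(k *: z)%R](addKr (a *: v + b *: w)%R) -[X in (_ + X)%R]addrA.
rewrite [X in S X]addrC.
by apply: (is_subspaceB hS) => //; apply: hS.2 => //; apply: (is_subspaceZ hS).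
Qed.

Section Concrete.
Local Open Scope classical_set_scope.
Local Open Scope ring_scope.
Variables (F : fieldType) (c : F) (A : vertex_superalgebra (VNS c)).
Hypotheses (A_VNS : is_VNS A) (two0 : 2%:R != 0 :> F) (three0 : 3%:R != 0 :> F).

Local Notation T := (VNScls c).
Local Notation e := (NSe F).
Let om := T (e (NSL (-2))).
Let tau := T (e (NSG (-2))).

Lemma VNScls_linear : linear T. Proof. exact: linearP. Qed.

Lemma VNScls_combination a b s t : T (a *: s + b *: t) = a *: T s + b *: T t.
Proof. by rewrite VNScls_linear (linear_funZ VNScls_linear). Qed.

Lemma NSleft_gen t :
  (exists a x y b, t = a * NSrel F x y * b) \/
  (exists a x, NSstar x /\ t = a * (e x - NSchar c x *: 1)) -> NSleft c t.
Proof. by move=> h J _; apply; exact: h. Qed.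

(** The generators of NS_* other than c annihilate the vacuum. *)
Lemma VNScls_killed x : NSstar x -> x <> NSC -> T (e x) = 0.
Proof.
move=> hx hC; rewrite -(linear_fun0 VNScls_linear).
apply/cls_eqP; rewrite subr0; apply: NSleft_gen; right; exists 1, x; split=> //.
by rewrite mul1r; case: x hx hC => // *; rewrite scale0r subr0.
Qed.

Lemma VNScls_killed_mul t x : NSstar x -> x <> NSC -> T (t * e x) = 0.
Proof.
move=> hx hC; rewrite -NSactE VNScls_killed // -(linear_fun0 VNScls_linear).
by rewrite NSactE mulr0.
Qed.

Lemma VNScls_C : T (e NSC) = c *: T 1.
Proof.
rewrite -(linear_funZ VNScls_linear); apply/cls_eqP; apply: NSleft_gen; right.
by exists 1, NSC; split=> //; rewrite mul1r.
Qed.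

Lemma VNScls_rel x y t :
  T (e x * (e y * t)) = (-1) ^+ (NSpar x && NSpar y) *: T (e y * (e x * t))
                      + T (NSbracket F x y * t).
Proof.
rewrite -(linear_funZ VNScls_linear) -(linear_funD VNScls_linear).
apply/cls_eqP; apply: NSleft_gen; left; exists 1, x, y, t.
exact: super_commutator_mulr.
Qed.

Lemma VNScls_bracket x y : NSstar x -> x <> NSC ->
  T (e x * e y) = T (NSbracket F x y).
Proof.
move=> hx hC; rewrite -[RHS]add0r.
rewrite -[X in X + _](scaler0 _ ((-1) ^+ (NSpar x && NSpar y))).
rewrite -(VNScls_killed_mul (e y) hx hC).
rewrite -(linear_funZ VNScls_linear) -(linear_funD VNScls_linear).
apply/cls_eqP; apply: NSleft_gen; left; exists 1, x, y, 1.
exact: super_commutator_mulr1.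
Qed.

Lemma Y_om m t : Y A om (m + 1) (T t) = T (e (NSL m) * t).
Proof. by have [_ _ h _] := A_VNS; rewrite h NSactE. Qed.

Lemma Y_tau n t : Y A tau (n + 1) (T t) = T (e (NSG n) * t).
Proof. by have [_ _ _ h] := A_VNS; rewrite h NSactE. Qed.

Lemma e_mul x (s : seq NSgen) :
  e x * << FMonom s >> = << FMonom (x :: s) >> :> NST F.
Proof.
rewrite /NSe malgM_def fgmulUU mulr1; congr << _ >>.
by apply/eqP; rewrite fmP fmM fmU.
Qed.

Lemma par_monomial (w : {fmonom NSgen}) :
  par A (odd (count NSpar w)) (T << w >>).
Proof.
have [_ -> _ _] := A_VNS; exists << w >> => //.
by move=> J _; apply; exists w.
Qed.

Lemma VNS_generate (P : set (VNS c)) : is_subspace P -> P (vac A) ->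
  (forall r v n, par A r v -> P v -> P (Y A om n v)) ->
  (forall r v n, par A r v -> P v -> P (Y A tau n v)) ->
  forall v, P v.
Proof.
move=> hP Pvac Pom Ptau v; have [hvac _ _ _] := A_VNS.
have hL r m t : par A r (T t) -> P (T t) -> P (T (e (NSL m) * t)).
  by move=> hr ht; rewrite -Y_om; apply: (Pom r).
have hG r m t : par A r (T t) -> P (T t) -> P (T (e (NSG m) * t)).
  by move=> hr ht; rewrite -Y_tau; apply: (Ptau r).
suff Pm (s : seq NSgen) : P (T << FMonom s >>).
  rewrite -[v]repK -[cls _ _]/(T (rep v)) (monalgE (rep v)).
  rewrite (linear_fun_sum VNScls_linear).
  apply: (is_subspace_sum hP) => k.
  rewrite (_ : << _ *g k >> = (rep v)@_k *: << FMonom k >>).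
    by rewrite (linear_funZ VNScls_linear); apply: (is_subspaceZ hP).
  by apply/malgP => k'; rewrite mcoeffZ !mcoeffU fmK mulr_natr.
elim: s => [|x s IH].
  rewrite (_ : << FMonom [::] >> = 1) -?hvac //.
  by congr << _ >>; apply/eqP; rewrite fmP fm1.
rewrite -e_mul; have hs := par_monomial (FMonom s).
case: x => [m|m|]; [exact: (hL _ _ _ hs) | exact: (hG _ _ _ hs) |].
(* The action of c is recovered from [G_(3/2), G_(-3/2)] = 2 L_0 + (2/3) c. *)
have hGs m : P (T (e (NSG m) * << FMonom s >>)) by apply: (hG _ _ _ hs).
have hGp m : exists r, par A r (T (e (NSG m) * << FMonom s >>)).
  by rewrite e_mul; eexists; apply: par_monomial.
have EB : T (NSbracket F (NSG 1) (NSG (-2)) * << FMonom s >>)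
    = 2%:R *: T (e (NSL 0) * << FMonom s >>)
      + (3%:R^-1 * (1 * (1 + 1))%:~R) *: T (e NSC * << FMonom s >>).
  apply: etrans (VNScls_combination _ _ _ _); apply: (congr1 T).
  exact: lalg_combination_mul.
have E := etrans (VNScls_rel (NSG 1) (NSG (-2)) << FMonom s >>)
  (congr1 (fun z => _ + z) EB).
apply: (is_subspace_solve hP _ E).
- by rewrite mul1r mulf_neq0 ?invr_eq0.
- by have [r hr] := hGp (-2); apply: (hG _ _ _ hr).
- by have [r hr] := hGp 1; apply: (hG _ _ _ hr).
- exact: (hL _ _ _ hs).
Qed.

Lemma VNScls_e1 x : T (e x * 1) = T (e x).
Proof. exact: (congr1 T (mulr1 _)). Qed.

Lemma VNScls_bracketLL m n : T (NSbracket F (NSL m) (NSL n))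
  = (m - n)%:~R *: T (e (NSL (m + n)))
    + (if m + n == 0 then 2%:R^-1 * binc F (m + 1)%:~R 3 else 0) *: T (e NSC).
Proof. exact: VNScls_combination. Qed.

Lemma VNScls_bracketLG m n : T (NSbracket F (NSL m) (NSG n))
  = (m%:~R / 2%:R - n%:~R - 2%:R^-1) *: T (e (NSG (m + n))).
Proof. exact: (linear_funZ VNScls_linear). Qed.

Lemma VNScls_bracketGG m n : T (NSbracket F (NSG m) (NSG n))
  = 2%:R *: T (e (NSL (m + (n + 1))))
    + (if m + (n + 1) == 0 then 3%:R^-1 * (m * (m + 1))%:~R else 0) *: T (e NSC).
Proof. exact: VNScls_combination. Qed.

Lemma Y_om_e (i : nat) x :
  Y A om i%:Z (T (e x)) = T (NSbracket F (NSL (i%:Z - 1)) x).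
Proof.
rewrite -{1}[i%:Z](subrK 1) Y_om VNScls_bracket //=; lia.
Qed.

Lemma Y_tau_e (i : nat) x :
  Y A tau i%:Z (T (e x)) = T (NSbracket F (NSG (i%:Z - 1)) x).
Proof.
rewrite -{1}[i%:Z](subrK 1) Y_tau VNScls_bracket //=; lia.
Qed.

Lemma VNS_pair : NS_pair A om tau.
Proof.
have [hvac _ _ _] := A_VNS.
have killL m : -1 <= m -> T (e (NSL m)) = 0 by move=> hm; apply: VNScls_killed.
have killG m : -1 <= m -> T (e (NSG m)) = 0 by move=> hm; apply: VNScls_killed.
split.
- have := par_monomial (fmu (NSL (-2))); by rewrite fmU.
- have := par_monomial (fmu (NSG (-2))); by rewrite fmU.
- rewrite (Y_om_e 0) VNScls_bracketLL scale0r addr0 scale1r.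
  by rewrite hvac -[-2](subrK 1) Y_om VNScls_e1.
- move=> i; rewrite Y_om_e VNScls_bracketLL VNScls_C -hvac scalerA.
  case: i => [|i]; first by do 2 eexists.
  rewrite killL; last by lia.
  by eexists 0, _; rewrite scaler0 scale0r.
- rewrite (Y_om_e 0) VNScls_bracketLG hvac -[-2](subrK 1) Y_tau VNScls_e1.
  rewrite (_ : _ / _ - _ - _ = 1) ?scale1r //.
  by rewrite -[(0%N%:Z - 1)%:~R]/(-1) mulN1r; field.
- move=> i; rewrite Y_om_e VNScls_bracketLG.
  case: i => [|i]; first by eexists.
  by exists 0; rewrite killG ?scaler0 ?scale0r //; lia.
- rewrite (Y_tau_e 0) VNScls_bracketGG scale0r addr0.
  by [].
- move=> i; rewrite Y_tau_e VNScls_bracketGG VNScls_C -hvac scalerA killL.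
    by eexists; rewrite scaler0 add0r.
  lia.
- exact: VNS_generate.
Qed.

Lemma e_exp x k : e x ^+ k = << FMonom (nseq k x) >> :> NST F.
Proof.
elim: k => [|k IH]; last by rewrite exprS IH e_mul.
by congr << _ >>; apply/eqP; rewrite fmP fm1.
Qed.

Lemma om_power_exp k : om_power A om k = T (e (NSL (-2)) ^+ k).
Proof.
have [hvac _ _ _] := A_VNS.
elim: k => [|k IH]; first exact: hvac.
by rewrite /om_power iterS -/(om_power A om k) IH -[-1](subrK 1) Y_om -exprS.
Qed.

Lemma VNSdeg_monomial (w : {fmonom NSgen}) :
  VNSdeg (\sum_(x <- w) NSdeg x) (T << w >>).
Proof. by exists << w >> => //; move=> J _; apply; exists w. Qed.

Lemma VNSdeg_om_power k : VNSdeg (k%:Z *+ 4) (om_power A om k).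
Proof.
rewrite om_power_exp e_exp; have := VNSdeg_monomial (FMonom (nseq k (NSL (-2)))).
by rewrite /= big_nseq iter_addr_0 (_ : _ *+ k = k%:Z *+ 4) //=; lia.
Qed.

Lemma om_power_I0 (p : nat) : prime p -> (2 < p)%N ->
  cls (ideal_subspace (NS_I0 A p)) (om_power A om p) = 0.
Proof.
move=> pr_p p2; rewrite -(raddf0 (cls (ideal_subspace (NS_I0 A p)))).
apply/cls_eqP; rewrite subr0 om_power_exp => J hJ; apply.
exists 2; split=> //; rewrite ifF ?subr0 //.
by apply/negP => /dvdn_leq; lia.
Qed.

End Concrete.

(** * Counting *)

(** If two objects with a common label below [k] are related, then at most [k]
    pairwise unrelated objects represent all the labelled ones. *)
Lemma finite_representatives (T : Type) (P : T -> Prop) (R : T -> T -> Prop)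
    (inv : nat -> T -> Prop) (k : nat) :
  (forall x, P x -> R x x) -> (forall x y, R x y -> R y x) ->
  (forall j x y, P x -> P y -> inv j x -> inv j y -> R x y) ->
  exists (n : nat) (M : 'I_n -> T),
    [/\ (n <= k)%N, forall i, P (M i), forall i j, R (M i) (M j) -> i = j &
        forall x j, P x -> (j < k)%N -> inv j x -> exists i, R x (M i)].
Proof.
move=> Rxx Rsym Rinv; elim: k => [|k [n [M [nk MP Minj Mex]]]].
  exists 0%N, (fun i : 'I_0 => let: Ordinal _ h := i in match notF h with end).
  by split=> // -[].
have [[x [Px ix hx]]|hno] := pselect (exists x,
    [/\ P x, inv k x & forall i, ~ R x (M i)]); last first.
  exists n, M; split=> // [|x j Px hj ix]; first exact: leqW.
  have [e|jk] := eqVneq j k; last by apply: Mex ix => //; lia.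
  apply: contrapT => h; apply: hno; exists x; split=> // [|i Ri].
    by rewrite -e.
  by apply: h; exists i.
pose M' (i : 'I_n.+1) := oapp M x (unlift ord0 i).
have M0 : M' ord0 = x by rewrite /M' unlift_none.
have ML i : M' (lift ord0 i) = M i by rewrite /M' liftK.
exists n.+1, M'; split=> //.
- by move=> i; case: (unliftP ord0 i) => [j|] ->; rewrite ?ML ?M0.
- move=> i j; case: (unliftP ord0 i) => [i'|] ->; case: (unliftP ord0 j) => [j'|] ->;
    rewrite ?ML ?M0 //.
  + by move=> /Minj ->.
  + by move=> /Rsym /hx.
  + by move=> /hx.
- move=> y j Py hj iy; have [e|jk] := eqVneq j k.
    by exists ord0; rewrite M0; apply: (Rinv k) => //; rewrite -e.
  have [|i Ri] := Mex y j Py _ iy; first by lia.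
  by exists (lift ord0 i); rewrite ML.
Qed.

Lemma closed_sqrt (F : closedFieldType) (a : F) : exists s : F, (s ^+ 2 = a)%R.
Proof.
have [s hs] := @solve_monicpoly F 2 (fun i => if i is 0%N then a else 0%R) isT.
by exists s; rewrite hs !big_ord_recl big_ord0 /= expr0 mulr1 mul0r !addr0.
Qed.

Theorem corollary7p6 (F : closedFieldType) (p : nat)
    (charF : (p \in [pchar F]%R)) (p_gt3 : (3 < p)%N) (c : F)
    (A : vertex_superalgebra (VNS c)) (A_VNS : is_VNS A) :
  exists (n : nat) (M : 'I_n -> twisted_module (VNS0 A p)),
    [/\ (n <= 2 * p)%N,
        forall i, tm_irreducible (M i) /\ tm_Ngraded (@VNS0deg F c A p) (M i),
        forall i j, tm_iso (M i) (M j) -> i = j &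
        forall W : twisted_module (VNS0 A p),
          tm_irreducible W -> tm_Ngraded (@VNS0deg F c A p) W ->
          exists i, tm_iso W (M i)].
Proof.
have nat_neq0 k : (0 < k < p)%N -> (k%:R != 0 :> F)%R.
  by move=> /andP[k0 kp]; rewrite -(dvdn_pcharf charF) gtnNdvd.
have two0 : (2%:R != 0 :> F)%R by apply: nat_neq0; lia.
have three0 : (3%:R != 0 :> F)%R by apply: nat_neq0; lia.
have pr_p := pcharf_prime charF.
set om := VNScls c (NSe F (NSL (-2))); set tau := VNScls c (NSe F (NSG (-2))).
pose pi := cls (ideal_subspace (NS_I0 A p)).
have hNS : NS_pair (VNS0 A p) (pi om) (pi tau).
  exact/NS_pair_quot/VNS_pair.
have deg_pi q v : VNSdeg q v -> @VNS0deg F c A p q (pi v) by move=> h; exists v.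
have deg_om : @VNS0deg F c A p 4 (pi om).
  apply: deg_pi; have := VNSdeg_monomial c (fmu (NSL (-2))).
  by rewrite fmU big_seq1.
have deg_tau : @VNS0deg F c A p 3 (pi tau).
  apply: deg_pi; have := VNSdeg_monomial c (fmu (NSG (-2))).
  by rewrite fmU big_seq1.
have deg_power k : @VNS0deg F c A p (k%:Z *+ 4)%R (om_power (VNS0 A p) (pi om) k).
  by rewrite om_power_quot; apply/deg_pi/VNSdeg_om_power.
have power_p : om_power (VNS0 A p) (pi om) p = 0%R.
  by rewrite om_power_quot; apply: om_power_I0 => //; lia.
have [kappa2 hkappa] := YW_G0_square hNS.
pose kappa : F := (kappa2 / 2%:R)%R.
have hG (W : twisted_module (VNS0 A p)) (w : W) :
    (YW (pi tau) 1 (YW (pi tau) 1 w) = YW (pi om) 2 w + kappa *: w)%R.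
  apply: (scalerI two0); rewrite hkappa scalerDr scalerA /kappa.
  by rewrite [(2%:R * _)%R]mulrC divfK.
have /choice[s hs] (j : nat) : exists t : F, (t ^+ 2 = kappa - j.*2%:R)%R.
  exact: closed_sqrt.
(* The labels: i = 2 j + b stands for the square root (-1)^b s_j of kappa - 2 j. *)
pose mu (i : nat) : F := ((-1) ^+ (odd i) * s i./2)%R.
pose inv (i : nat) (W : twisted_module (VNS0 A p)) := exists gr : nat -> set W,
  [/\ direct_sum_decomposition gr, gr_action (@VNS0deg F c A p) gr &
      exists w, lowest_weight (pi om) (pi tau) gr (- (i./2).*2%:R)%R (mu i) w].
pose P (W : twisted_module (VNS0 A p)) :=
  tm_irreducible W /\ tm_Ngraded (@VNS0deg F c A p) W.
have [|||n [M [nk MP Minj Mex]]] :=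
  @finite_representatives _ P (@tm_iso _ _ _) inv (2 * p).
- by move=> W _; apply: (@tm_iso_of_linear _ _ _ W W id) => //; exists id.
- exact: tm_iso_sym.
- move=> i W1 W2 [irr1 _] [irr2 _] [gr1 [d1 a1 [w1 l1]]] [gr2 [d2 a2 [w2 l2]]].
  exact: (lowest_weight_iso hNS deg_om deg_tau irr1 d1 a1 irr2 d2 a2 l1 l2).
exists n, M; split=> // W irr [gr [d w0 a]].
have [j [b [w lw]]] := lowest_weight_exists hNS deg_om deg_tau deg_power two0 hs
  (hG W) power_p d a w0.
apply: (Mex W (b + j.*2)%N); first by split=> //; exists gr.
  by have := ltn_ord j; case: (b) => /=; lia.
exists gr; split=> //; exists w.
by rewrite /mu oddD odd_double addbF oddb half_bit_double.
Qed.
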